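(* Let $\alpha,\beta\in\mathbb{C}$ satisfy $\alpha^2,\beta^2\neq 0,1$, $\alpha^2\neq\beta^2$, $\alpha^2\beta^2\neq 1$. For $i=1,2$ let $\psi_{i,*}\colon \operatorname{Jac}(V)\to\operatorname{Jac}(E_i)$ be the homomorphism defined in the context, and let $\pi\colon\mathbb{C}^2\to\operatorname{Jac}(V)$, $\pi_i\colon\mathbb{C}\to\operatorname{Jac}(E_i)$ be the natural projections. Consider the maps $$\widetilde{\psi}_{i,*}\colon\ \mathbb{C}^2\to\mathbb{C},\qquad {}^t(u_1,u_3)\mapsto a_iu_1+b_iu_3,\qquad i=1,2,$$ where $$a_1=1-\alpha\beta,\quad b_1=\alpha\beta(1-\alpha\beta),\quad a_2=\alpha\beta+1,\quad b_2=-\alpha\beta(\alpha\beta+1).$$ Then $\psi_{i,*}\circ\pi=\pi_i\circ\widetilde{\psi}_{i,*}$ for $i=1,2$.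
   Context: For a complex number $z$, $\sqrt{z}$ denotes a (chosen) complex number whose square is $z$. Curves. $V$ is the nonsingular hyperelliptic curve of genus 2 with affine equation $y^2=x(x-1)(x-\alpha^2)(x-\beta^2)(x-\alpha^2\beta^2)$, together with its one point $\infty$ at infinity. $E_1$ and $E_2$ are the elliptic curves $$E_1:\ Y^2=X(X-1)\Big(X-\frac{(\alpha-\beta)^2}{(\alpha\beta-1)^2}\Big),\qquad E_2:\ Y^2=X(X-1)\Big(X-\frac{(\alpha+\beta)^2}{(\alpha\beta+1)^2}\Big),$$ each with its point $\infty$ at infinity, which is the identity of the group law. Morphisms of degree 2. $$\varphi_1\colon V\to E_1,\ (x,y)\mapsto\Big(\frac{(\alpha-\beta)^2x}{(x-\alpha\beta)^2},\frac{(\alpha-\beta)^2y}{(\alpha\beta-1)(x-\alpha\beta)^3}\Big),$$ $$\varphi_2\colon V\to E_2,\ (x,y)\mapsto\Big(\frac{(\alpha+\beta)^2x}{(x+\alpha\beta)^2},\frac{-(\alpha+\beta)^2y}{(\alpha\beta+1)(x+\alpha\beta)^3}\Big).$$ (Points with $x=\alpha\beta$ go to $\infty$ under $\varphi_1$, points with $x=-\alpha\beta$ go to $\infty$ under $\varphi_2$, and $\varphi_i(\infty)=(0,0)$.) Jacobians. On $V$ put $\omega_1=-\frac{x}{2y}dx$, $\omega_3=-\frac{1}{2y}dx$, $\boldsymbol\omega={}^t(\omega_1,\omega_3)$; $\Lambda\subset\mathbb{C}^2$ is the lattice of periods of $\boldsymbol\omega$ over $H_1(V,\mathbb{Z})$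 and $\operatorname{Jac}(V)=\mathbb{C}^2/\Lambda$, with coordinates ${}^t(u_1,u_3)$ on $\mathbb{C}^2$. On $E_i$ put $\Omega_i=-\frac{dX}{2Y}$; $\Lambda_i\subset\mathbb{C}$ is the lattice of periods of $\Omega_i$ over $H_1(E_i,\mathbb{Z})$ and $\operatorname{Jac}(E_i)=\mathbb{C}/\Lambda_i$. Maps. Let $O_1=(\alpha\beta,\ \alpha\beta\sqrt{\alpha\beta}(\alpha\beta-1)(\alpha-\beta))$ and $O_2=(-\alpha\beta,\ \alpha\beta\sqrt{-\alpha\beta}(\alpha\beta+1)(\alpha+\beta))$, points of $V$ with $\varphi_i(O_i)=\infty$. Let $I_i\colon V\to\operatorname{Jac}(V)$, $P\mapsto\int_{O_i}^P\boldsymbol\omega$. Let $\varphi_{i,*}\colon\operatorname{Jac}(V)\to E_i$ be the unique holomorphic group homomorphism with $\varphi_i=\varphi_{i,*}\circ I_i$ (it exists since $\operatorname{Jac}(V)$ is the Albanese variety of $V$). Let $J_i\colon E_i\to\operatorname{Jac}(E_i)$, $S\mapsto\int_\infty^S\Omega_i$ (an isomorphism), and $\psi_{i,*}=J_i\circ\varphi_{i,*}$. *)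

(* Defs.v *)
From Stdlib Require Import Reals List ClassicalEpsilon.
From Coquelicot Require Import Coquelicot.
Import ListNotations.
Open Scope C_scope.

(** * Hyperelliptic curves with one point at infinity

    [Build_hcurve g [e_1; ...; e_(2g+1)]] stands for the smooth projective
    model of  y^2 = (x - e_1) ... (x - e_(2g+1)), the [e_j] being pairwise
    distinct.  It is obtained by gluing two smooth affine plane curves:
    - [Finite_chart]:    y^2 = (x - e_1) ... (x - e_(2g+1));
    - [Infinity_chart]:  w^2 = s (1 - e_1 s) ... (1 - e_(2g+1) s),
    along  s = 1/x,  w = y/x^(g+1).  The point at infinity is (s,w) = (0,0). *)

Record hcurve := { hgenus : nat; hroots : list C }.

Inductive point := Aff (x y : C) | Inf.

Inductive chart := Finite_chart | Infinity_chart.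

Definition Cprod (l : list C) : C := fold_right Cmult 1 l.

Definition rhs (X : hcurve) (k : chart) (a : C) : C :=
  match k with
  | Finite_chart => Cprod (map (fun e => a - e) (hroots X))
  | Infinity_chart => a * Cprod (map (fun e => 1 - e * a) (hroots X))
  end.

Definition on_chart (X : hcurve) (k : chart) (a b : C) : Prop :=
  b ^ 2 = rhs X k a.

Definition chart_point (X : hcurve) (k : chart) (a b : C) : point :=
  match k with
  | Finite_chart => Aff a b
  | Infinity_chart =>
      if Ceq_dec a 0 then Inf else Aff (/ a) (b / a ^ (S (hgenus X)))
  end.

Definition on_curve (X : hcurve) (P : point) : Prop :=
  match P with
  | Aff x y => on_chart X Finite_chart x y
  | Inf => True
  end.

(** * Holomorphic differentials and their integrals

    The list [c_0; ...; c_(g-1)] stands for the holomorphic 1-form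
    (c_0 + c_1 x + ... + c_(g-1) x^(g-1)) dx / (2y).  Substituting x = 1/s and
    y = w/s^(g+1) turns it into
    - (c_(g-1) + c_(g-2) s + ... + c_0 s^(g-1)) ds / (2w). *)

Definition hform := list C.

Fixpoint Ceval (p : list C) (z : C) : C :=
  match p with
  | [] => 0
  | c :: p' => c + z * Ceval p' z
  end.

Definition numerator (w : hform) (k : chart) (a : C) : C :=
  match k with
  | Finite_chart => Ceval w a
  | Infinity_chart => - Ceval (rev w) a
  end.

(** [form_value X w k a b da db c]: the form [w] takes the value [c] on the
    tangent vector [(da, db)] at the point [(a, b)] of the chart [k].  With
    b^2 = f(a), the form is h da/(2b) = h db/f'(a); the first expression
    determines [c] where b <> 0, the second one at the branch points b = 0. *)
Definition form_value (X : hcurve) (w : hform) (k : chart)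
    (a b da db c : C) : Prop :=
  2 * b * c = numerator w k a * da /\
  (forall d : C,
     is_derive (K := C_AbsRing) (V := C_NormedModule) (rhs X k) a d ->
     d * c = numerator w k a * db).

Definition C1_near (a a' : R -> C) (t : R) : Prop :=
  locally t (fun s : R =>
    is_derive (K := R_AbsRing) (V := C_R_NormedModule) a s (a' s) /\
    continuous (T := R_UniformSpace) (U := C_UniformSpace) a' s).

(** In a chart, [(a, b)] are the coordinates of the path [g] near [t], and
    [(a', b')] those of its velocity. *)
Definition path_coords (X : hcurve) (g : R -> point) (t : R) (k : chart)
    (a b a' b' : R -> C) : Prop :=
  locally t (fun s : R =>
    on_chart X k (a s) (b s) /\ g s = chart_point X k (a s) (b s)) /\
  C1_near a a' t /\ C1_near b b' t.

(** A C^1 arc is parametrized by [0,1].  A C^1 path on the closed interval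
    always extends to a neighbourhood, so that we may ask for smoothness at
    each point of [0,1] in the two-sided sense. *)
Definition C1_arc (X : hcurve) (g : R -> point) : Prop :=
  forall t : R, (0 <= t <= 1)%R ->
    exists k a b a' b', path_coords X g t k a b a' b'.

Definition is_arc_integral (X : hcurve) (w : hform) (g : R -> point) (v : C)
    : Prop :=
  exists c : R -> C,
    (forall t : R, (0 <= t <= 1)%R ->
       exists k a b a' b', path_coords X g t k a b a' b' /\
         form_value X w k (a t) (b t) (a' t) (b' t) (c t)) /\
    is_RInt (V := C_R_NormedModule) c 0 1 v.

(** A piecewise C^1 path is the list of its consecutive arcs. *)
Definition path := list (R -> point).

Fixpoint is_path (X : hcurve) (P : point) (l : path) (Q : point) : Prop :=
  match l with
  | [] => on_curve X P /\ P = Q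
  | g :: l' => C1_arc X g /\ g 0%R = P /\ is_path X (g 1%R) l' Q
  end.

Fixpoint is_path_integral (X : hcurve) (w : hform) (l : path) (v : C) : Prop :=
  match l with
  | [] => v = 0
  | g :: l' =>
      exists v1 v2, is_arc_integral X w g v1 /\ is_path_integral X w l' v2 /\
        v = v1 + v2
  end.

(** * Quotients of abelian groups *)

Inductive generated {G : AbelianGroup} (S : G -> Prop) : G -> Prop :=
  | generated_in u : S u -> generated S u
  | generated_zero : generated S zero
  | generated_plus u v : generated S u -> generated S v ->
      generated S (plus u v)
  | generated_opp u : generated S u -> generated S (opp u).

Definition coset {G : AbelianGroup} (L : G -> Prop) (u : G) : G -> Prop :=
  fun v => L (minus v u).

Record quotient (G : AbelianGroup) (L : G -> Prop) := {
  qclass : G -> Prop;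
  qclassP : exists u, qclass = coset L u }.

Definition proj {G : AbelianGroup} (L : G -> Prop) (u : G) : quotient G L :=
  Build_quotient G L (coset L u) (ex_intro _ u eq_refl).

Definition repr {G : AbelianGroup} {L : G -> Prop} (q : quotient G L) : G :=
  proj1_sig (constructive_indefinite_description _ (qclassP G L q)).

(** The group law of the quotient when [L] is a subgroup. *)
Definition qplus {G : AbelianGroup} {L : G -> Prop} (p q : quotient G L)
    : quotient G L :=
  proj L (plus (repr p) (repr q)).

(** * Period lattices, Jacobians, Abel-Jacobi maps

    Here [Int l v] means that [v] is the integral along [l] of a fixed (vector
    of) form(s) with values in [G], which is C or C^2. *)

(** Each class in H_1(X, Z) is a sum of classes of closed piecewise C^1 paths,
    so the periods over H_1(X, Z) are the sums of the integrals along these. *)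
Definition periods (X : hcurve) {G : AbelianGroup} (Int : path -> G -> Prop)
    : G -> Prop :=
  generated (fun v => exists P l, is_path X P l P /\ Int l v).

Definition Jac (X : hcurve) {G : AbelianGroup} (Int : path -> G -> Prop) : Type :=
  quotient G (periods X Int).

(** The class modulo periods of the integral from [O] to [P], along a path
    chosen arbitrarily. *)
Definition abel_jacobi (X : hcurve) {G : AbelianGroup} (Int : path -> G -> Prop)
    (O P : point) : Jac X Int :=
  proj (periods X Int)
    (epsilon (inhabits zero) (fun v => exists l, is_path X O l P /\ Int l v)).

(** * Genus 1: Legendre curves  Y^2 = X (X - 1) (X - lambda) *)

Definition legendre (lambda : C) : hcurve :=
  {| hgenus := 1; hroots := [RtoC 0; RtoC 1; lambda] |}.

(** Chord-tangent addition on Y^2 = X^3 - (1 + lambda) X^2 + lambda X. *)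
Definition legendre_add (lambda : C) (P Q : point) : point :=
  match P, Q with
  | Inf, _ => Q
  | _, Inf => P
  | Aff x1 y1, Aff x2 y2 =>
      let third m :=
        let x3 := m ^ 2 + (1 + lambda) - x1 - x2 in
        Aff x3 (- (y1 + m * (x3 - x1))) in
      if Ceq_dec x1 x2 then
        if Ceq_dec (y1 + y2) 0 then Inf
        else third ((3 * x1 ^ 2 - 2 * (1 + lambda) * x1 + lambda) / (2 * y1))
      else third ((y2 - y1) / (x2 - x1))
  end.

(** Omega = - dX / (2Y) *)
Definition Omega_integral (lambda : C) : path -> C_AbelianGroup -> Prop :=
  is_path_integral (legendre lambda) [- RtoC 1].

Definition JacE (lambda : C) : Type :=
  Jac (legendre lambda) (Omega_integral lambda).

Definition projE (lambda : C) : C_AbelianGroup -> JacE lambda :=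
  proj (periods (legendre lambda) (Omega_integral lambda)).

Definition J_map (lambda : C) : point -> JacE lambda :=
  abel_jacobi (legendre lambda) (Omega_integral lambda) Inf.

(** * The curve V of genus 2 *)

Definition C2 : NormedModule C_AbsRing :=
  prod_NormedModule C_AbsRing C_NormedModule C_NormedModule.

Definition curveV (alpha beta : C) : hcurve :=
  {| hgenus := 2;
     hroots := [RtoC 0; RtoC 1; alpha ^ 2; beta ^ 2; alpha ^ 2 * beta ^ 2] |}.

(** omega_1 = - x dx / (2y)  and  omega_3 = - dx / (2y) *)
Definition omega_integral (alpha beta : C) (l : path) (u : C2) : Prop :=
  is_path_integral (curveV alpha beta) [RtoC 0; - RtoC 1] l (fst u) /\
  is_path_integral (curveV alpha beta) [- RtoC 1; RtoC 0] l (snd u).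

Definition JacV (alpha beta : C) : Type :=
  Jac (curveV alpha beta) (omega_integral alpha beta).

Definition projV (alpha beta : C) : C2 -> JacV alpha beta :=
  proj (periods (curveV alpha beta) (omega_integral alpha beta)).

Definition I_map (alpha beta : C) (O : point) : point -> JacV alpha beta :=
  abel_jacobi (curveV alpha beta) (omega_integral alpha beta) O.

(** Holomorphic maps from C^2 to a curve; in either chart the curve is a closed
    submanifold of C^2, so both affine coordinates may be tested. *)
Definition holomorphic_near (f : C2 -> C) (u : C2) : Prop :=
  locally u (fun v : C2 =>
    ex_filterdiff (K := C_AbsRing) (V := C_NormedModule) f (locally v)).

Definition holomorphic_to (X : hcurve) (F : C2 -> point) : Prop :=
  forall u : C2, exists (k : chart) (a b : C2 -> C),
    locally u (fun v : C2 =>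
      on_chart X k (a v) (b v) /\ F v = chart_point X k (a v) (b v)) /\
    holomorphic_near a u /\ holomorphic_near b u.

(** The complex structure of Jac(V) is the one for which [projV] is a local
    biholomorphism. *)
Definition holomorphic_hom (alpha beta lambda : C)
    (F : JacV alpha beta -> point) : Prop :=
  (forall p, on_curve (legendre lambda) (F p)) /\
  (forall p q, F (qplus p q) = legendre_add lambda (F p) (F q)) /\
  holomorphic_to (legendre lambda) (fun u => F (projV alpha beta u)).

(** * The two quotients of V *)

Definition lambda1 (alpha beta : C) : C :=
  (alpha - beta) ^ 2 / (alpha * beta - 1) ^ 2.

Definition lambda2 (alpha beta : C) : C :=
  (alpha + beta) ^ 2 / (alpha * beta + 1) ^ 2.

Definition phi1 (alpha beta : C) (P : point) : point :=
  match P with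
  | Inf => Aff 0 0
  | Aff x y =>
      if Ceq_dec x (alpha * beta) then Inf
      else Aff ((alpha - beta) ^ 2 * x / (x - alpha * beta) ^ 2)
               ((alpha - beta) ^ 2 * y /
                ((alpha * beta - 1) * (x - alpha * beta) ^ 3))
  end.

Definition phi2 (alpha beta : C) (P : point) : point :=
  match P with
  | Inf => Aff 0 0
  | Aff x y =>
      if Ceq_dec x (- (alpha * beta)) then Inf
      else Aff ((alpha + beta) ^ 2 * x / (x + alpha * beta) ^ 2)
               (- (alpha + beta) ^ 2 * y /
                ((alpha * beta + 1) * (x + alpha * beta) ^ 3))
  end.

(** [r] is the chosen square root of [alpha * beta], resp. [- alpha * beta]. *)
Definition O1 (alpha beta r : C) : point :=
  Aff (alpha * beta)
      (alpha * beta * r * (alpha * beta - 1) * (alpha - beta)).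

Definition O2 (alpha beta r : C) : point :=
  Aff (- (alpha * beta))
      (alpha * beta * r * (alpha * beta + 1) * (alpha + beta)).

(** [F : Jac(V) -> E] is the homomorphism through which [phi : V -> E]
    factors, V being mapped to Jac(V) with base point [O]. *)
Definition is_pushforward (alpha beta lambda : C) (phi : point -> point)
    (O : point) (F : JacV alpha beta -> point) : Prop :=
  holomorphic_hom alpha beta lambda F /\
  (forall P, on_curve (curveV alpha beta) P -> phi P = F (I_map alpha beta O P)).

Definition psi_star (alpha beta lambda : C) (F : JacV alpha beta -> point)
    (p : JacV alpha beta) : JacE lambda :=
  J_map lambda (F p).

Definition psi_tilde (a b : C) (u : C2) : C := a * fst u + b * snd u.

(* Main.v *)
Require Import Defs.
From Stdlib Require Import Reals Lra List ClassicalEpsilon.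
From Stdlib Require Import FunctionalExtensionality PropExtensionality.
From Stdlib Require Import ProofIrrelevance.
From Coquelicot Require Import Coquelicot.
Import ListNotations.
Open Scope C_scope.

(** Write [G u = F (proj u)] for the lift to [C^2] of a pushforward
    [F : Jac(V) -> E].  It is a homomorphism, holomorphic near 0, so near 0 it
    is given by the coordinates [(s, w) = (1/X, Y/X^2)] at the point at
    infinity of [E], and [dw] at 0 is a linear form [A u_1 + B u_3].

    The invariant form [Omega = -dX/2Y] equals [dw] at infinity and is
    invariant under translations.  Concretely, translation by an affine point
    [(x1, y1)] is near infinity a rational map in [(s, w)], regular at [(0, 0)],
    whose derivative along the curve there is
    [dw |-> (-2 y1 dw, - f'(x1) dw)], where [Y^2 = f(X)] is the equation of [E]
    ([is_derive_translate]).  Since [G (u + h) = G u + G h], one differentiation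
    at 0 gives the derivative of [G] everywhere: along any path [u(t)], the
    affine coordinates of [G (u(t))] satisfy [X' = -2 Y D] and
    [Y' = - f'(X) D] with [D = A u_1' + B u_3'] ([hom_near_affine]).  Their
    right-hand sides are continuous, so [G] is of class C^1 along lines.

    Two consequences finish the proof.

    - Along [t |-> t u] the integrand of [Omega] is the constant
      [A u_1 + B u_3].  So this number is an integral of [Omega] from infinity
      to [G u], and [J (G u)] is its class ([J_map_hom]).

    - Take an arc [t |-> (e + t, y(t))] on [V] issuing from the base point,
      where [e] is the abscissa of the base point, and let [U(t)] be the
      integral of the forms along it.  Then [G (U(t)) = phi (e + t, y(t))], and
      [X] is an explicit rational function of [t].  Comparing its derivative
      with [X' = -2 Y D] gives an equality of affine functions of [t] for small
      [t > 0], which determines [A] and [B] ([pushforward_differential]).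

    Both coverings have the shape
    [(x, y) |-> (K x / (x - e)^2, M y / (x - e)^3)], with [e] equal to
    [alpha beta] or to [- alpha beta], for which [A = - K/M] and
    [B = - K e/M]. *)

(** * Derivatives of complex-valued functions of a real variable *)

(** Complex-valued functions of a real variable, with [C] as a real normed
    space; the product and quotient rules are proved by components. *)
Notation is_derive_RC := (is_derive (K := R_AbsRing) (V := C_R_NormedModule)).

Lemma is_derive_RC_components (f : R -> C) (t : R) (l : C) :
  is_derive_RC f t l <->
  is_derive (fun s => fst (f s)) t (fst l) /\
  is_derive (fun s => snd (f s)) t (snd l).
Proof.
  split.
  - intros H. split.
    + apply (filterdiff_comp (K := R_AbsRing) f fst _ fst H).
      apply filterdiff_linear, is_linear_fst.
    + apply (filterdiff_comp (K := R_AbsRing) f snd _ snd H).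
      apply filterdiff_linear, is_linear_snd.
  - intros [H1 H2].
    apply (filterdiff_ext_lin (K := R_AbsRing) (V := C_R_NormedModule) f
             (fun y => (scal y (fst l), scal y (snd l)))); [|now intros y].
    apply (filterdiff_ext (K := R_AbsRing) (V := C_R_NormedModule)
             (fun s => (fst (f s), snd (f s)))).
    { intros s. now destruct (f s). }
    apply (filterdiff_comp_2 (K := R_AbsRing) (W := C_R_NormedModule)
      (fun s => fst (f s)) (fun s => snd (f s)) (fun x y => (x, y)) _ _
      (fun x y => (x, y)) H1 H2).
    apply (filterdiff_ext (K := R_AbsRing)
            (U := prod_NormedModule R_AbsRing R_NormedModule R_NormedModule)
            (V := C_R_NormedModule) (fun x => x)).
    { now intros [x y]. }
    apply (filterdiff_ext_lin (K := R_AbsRing)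
            (U := prod_NormedModule R_AbsRing R_NormedModule R_NormedModule)
            (V := C_R_NormedModule) _ (fun x => x)).
    { apply filterdiff_id. }
    now intros [x y].
Qed.

Lemma is_derive_RC_unique (f : R -> C) (t : R) (l l' : C) :
  is_derive_RC f t l -> is_derive_RC f t l' -> l = l'.
Proof.
  intros [H1 H2]%is_derive_RC_components [H1' H2']%is_derive_RC_components.
  apply injective_projections.
  - now rewrite <- (is_derive_unique _ _ _ H1), <- (is_derive_unique _ _ _ H1').
  - now rewrite <- (is_derive_unique _ _ _ H2), <- (is_derive_unique _ _ _ H2').
Qed.

Lemma is_derive_RC_ext_loc (f g : R -> C) (t : R) (l l' : C) :
  locally t (fun s => f s = g s) -> l = l' ->
  is_derive_RC f t l -> is_derive_RC g t l'.
Proof. intros H <-. now apply is_derive_ext_loc. Qed.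

Lemma is_derive_RC_eq (f : R -> C) (t : R) (l l' : C) :
  is_derive_RC f t l -> l = l' -> is_derive_RC f t l'.
Proof. now intros H <-. Qed.

Lemma is_derive_RC_plus (f g : R -> C) (t : R) (df dg : C) :
  is_derive_RC f t df -> is_derive_RC g t dg ->
  is_derive_RC (fun s => f s + g s) t (df + dg).
Proof.
  exact (is_derive_plus (K := R_AbsRing) (V := C_R_NormedModule) f g t df dg).
Qed.

Lemma is_derive_RC_opp (f : R -> C) (t : R) (df : C) :
  is_derive_RC f t df -> is_derive_RC (fun s => - f s) t (- df).
Proof.
  exact (is_derive_opp (K := R_AbsRing) (V := C_R_NormedModule) f t df).
Qed.

Lemma is_derive_RC_minus (f g : R -> C) (t : R) (df dg : C) :
  is_derive_RC f t df -> is_derive_RC g t dg ->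
  is_derive_RC (fun s => f s - g s) t (df - dg).
Proof.
  exact (is_derive_minus (K := R_AbsRing) (V := C_R_NormedModule) f g t df dg).
Qed.

Lemma is_derive_RC_const (c : C) (t : R) :
  is_derive_RC (fun _ => c) t (RtoC 0).
Proof. apply (is_derive_const (K := R_AbsRing) (V := C_R_NormedModule)). Qed.

Lemma is_derive_RC_id (t : R) : is_derive_RC RtoC t (RtoC 1).
Proof.
  apply is_derive_RC_components; split; simpl.
  - apply (is_derive_id (K := R_AbsRing)).
  - apply (is_derive_const (K := R_AbsRing) (V := R_NormedModule)).
Qed.

Lemma is_derive_RC_mult (f g : R -> C) (t : R) (df dg : C) :
  is_derive_RC f t df -> is_derive_RC g t dg ->
  is_derive_RC (fun s => f s * g s) t (df * g t + f t * dg).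
Proof.
  intros [F1 F2]%is_derive_RC_components [G1 G2]%is_derive_RC_components.
  apply is_derive_RC_components; split; simpl;
    set (f1 := fun s => fst (f s)) in *; set (f2 := fun s => snd (f s)) in *;
    set (g1 := fun s => fst (g s)) in *; set (g2 := fun s => snd (g s)) in *.
  - change (is_derive (fun s => f1 s * g1 s - f2 s * g2 s)%R t
      ((fst df * g1 t - snd df * g2 t) + (f1 t * fst dg - f2 t * snd dg))%R).
    auto_derive.
    + repeat split; eexists; eassumption.
    + rewrite (is_derive_unique (fun x : R => f1 x) t _ F1),
        (is_derive_unique (fun x : R => f2 x) t _ F2),
        (is_derive_unique (fun x : R => g1 x) t _ G1),
        (is_derive_unique (fun x : R => g2 x) t _ G2). ring.
  - change (is_derive (fun s => f1 s * g2 s + f2 s * g1 s)%R t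
      ((fst df * g2 t + snd df * g1 t) + (f1 t * snd dg + f2 t * fst dg))%R).
    auto_derive.
    + repeat split; eexists; eassumption.
    + rewrite (is_derive_unique (fun x : R => f1 x) t _ F1),
        (is_derive_unique (fun x : R => f2 x) t _ F2),
        (is_derive_unique (fun x : R => g1 x) t _ G1),
        (is_derive_unique (fun x : R => g2 x) t _ G2). ring.
Qed.

Lemma Csqr_norm_neq_0 (z : C) : z <> 0 -> (fst z ^ 2 + snd z ^ 2 <> 0)%R.
Proof.
  intros H E. apply H. apply injective_projections; simpl; nra.
Qed.

Lemma is_derive_RC_inv (f : R -> C) (t : R) (df : C) :
  f t <> 0 -> is_derive_RC f t df ->
  is_derive_RC (fun s => / f s) t (- (df / (f t * f t))).
Proof.
  intros Hf [F1 F2]%is_derive_RC_components.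
  pose proof (Csqr_norm_neq_0 _ Hf) as N.
  pose proof (Csqr_norm_neq_0 _ (Cmult_neq_0 _ _ Hf Hf)) as N2.
  simpl in N, N2.
  apply is_derive_RC_components; split;
    set (f1 := fun s => fst (f s)) in *; set (f2 := fun s => snd (f s)) in *.
  - change (is_derive (fun s => f1 s / (f1 s ^ 2 + f2 s ^ 2))%R t
       (fst (- (df / (f t * f t))))).
    auto_derive.
    + repeat split; try (eexists; eassumption); assumption.
    + rewrite (is_derive_unique (fun x : R => f1 x) t _ F1),
        (is_derive_unique (fun x : R => f2 x) t _ F2).
      unfold f1, f2 in *; simpl. field.
      split; intros E; [apply N2|apply N]; rewrite <- E; ring.
  - change (is_derive (fun s => - f2 s / (f1 s ^ 2 + f2 s ^ 2))%R t
       (snd (- (df / (f t * f t))))).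
    auto_derive.
    + repeat split; try (eexists; eassumption); assumption.
    + rewrite (is_derive_unique (fun x : R => f1 x) t _ F1),
        (is_derive_unique (fun x : R => f2 x) t _ F2).
      unfold f1, f2 in *; simpl. field.
      split; intros E; [apply N2|apply N]; rewrite <- E; ring.
Qed.

Lemma is_derive_RC_div (f g : R -> C) (t : R) (df dg : C) :
  g t <> 0 -> is_derive_RC f t df -> is_derive_RC g t dg ->
  is_derive_RC (fun s => f s / g s) t ((df * g t - f t * dg) / (g t * g t)).
Proof.
  intros Hg F G.
  apply (is_derive_RC_eq _ _ _ _
           (is_derive_RC_mult _ _ _ _ _ F (is_derive_RC_inv _ _ _ Hg G))).
  now field.
Qed.

Lemma is_derive_RC_continuous (f : R -> C) (t : R) (df : C) :
  is_derive_RC f t df ->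
  continuous (T := R_UniformSpace) (U := C_UniformSpace) f t.
Proof.
  intros H. apply (ex_derive_continuous (K := R_AbsRing) (V := C_R_NormedModule)).
  now exists df.
Qed.

Lemma norm_C_R (z : C) : norm (V := C_R_NormedModule) z = Cmod z.
Proof.
  change (sqrt (Rabs (fst z) ^ 2 + Rabs (snd z) ^ 2) =
          sqrt (fst z ^ 2 + snd z ^ 2)).
  now rewrite !pow2_abs.
Qed.

(** The norm of the real vector space [C] is [Cmod], so that a real derivative
    can be compared with estimates over the complex field. *)
Lemma is_derive_RC_eps (f : R -> C) (t : R) (l : C) :
  is_derive_RC f t l <->
  forall eps : posreal, locally t (fun s : R =>
    (Cmod (f s - f t - RtoC (s - t) * l) <= eps * Rabs (s - t))%R).
Proof.
  assert (E : forall s, norm (V := C_R_NormedModule)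
     (minus (minus (f s) (f t)) (scal (minus s t) l)) =
      Cmod (f s - f t - RtoC (s - t) * l)).
  { intros s. rewrite norm_C_R. f_equal.
    unfold minus, plus, opp, scal; simpl. unfold prod_scal, scal; simpl.
    unfold mult; simpl.
    apply injective_projections; simpl; ring. }
  split.
  - intros [_ H] eps. generalize (H t (fun P HP => HP) eps).
    apply filter_imp. intros s Hs. rewrite <- E. exact Hs.
  - intros H. split; [apply is_linear_scal_l|].
    intros x Hx eps.
    apply (is_filter_lim_locally_unique (V := R_NormedModule) t x) in Hx.
    subst x.
    generalize (H eps). apply filter_imp. intros s Hs. rewrite <- E in Hs. exact Hs.
Qed.

(** Chain rule across two base fields: a map which is differentiable over [C]
    is composed with a path of real parameter.  The path is given by an
    estimate in the norm of [U], since [U] is not a normed module over [R]. *)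
Lemma is_derive_RC_chain (U : NormedModule C_AbsRing) (f : U -> C)
    (df : U -> C) (g : R -> U) (t : R) (dg : U) :
  filterdiff (V := C_NormedModule) f (locally (g t)) df ->
  (forall eps : posreal, locally t (fun s : R =>
    (norm (minus (minus (g s) (g t)) (scal (RtoC (s - t)) dg))
       <= eps * Rabs (s - t))%R)) ->
  is_derive_RC (fun s => f (g s)) t (df dg).
Proof.
  intros [Hlin Hdom] Hg. apply is_derive_RC_eps. intros eps.
  destruct (linear_norm _ Hlin) as [M [HM HMn]].
  pose (N := (1 + norm dg)%R).
  assert (HN : (0 < N)%R) by (pose proof (norm_ge_0 dg); unfold N; lra).
  assert (Hlip : locally t (fun s : R =>
            (norm (minus (g s) (g t)) <= N * Rabs (s - t))%R)).
  { generalize (Hg (mkposreal 1 Rlt_0_1)). apply filter_imp. intros s Hs.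
    cbn [pos] in Hs.
    replace (minus (g s) (g t)) with
      (plus (minus (minus (g s) (g t)) (scal (RtoC (s - t)) dg))
            (scal (RtoC (s - t)) dg)).
    2:{ unfold minus at 1. rewrite <- plus_assoc, plus_opp_l. apply plus_zero_r. }
    eapply Rle_trans; [apply norm_triangle|].
    pose proof (norm_scal (RtoC (s - t)) dg) as E.
    change (abs (RtoC (s - t))) with (Cmod (RtoC (s - t))) in E.
    rewrite Cmod_R in E.
    eapply Rle_trans; [exact (Rplus_le_compat _ _ _ _ Hs E)|].
    unfold N. lra. }
  assert (He1 : (0 < eps / (2 * N))%R).
  { apply Rdiv_lt_0_compat; [apply cond_pos|lra]. }
  assert (He2 : (0 < eps / (2 * M))%R).
  { apply Rdiv_lt_0_compat; [apply cond_pos|lra]. }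
  assert (Hcont : filterlim g (locally t) (locally (g t))).
  { intros P HP. apply locally_norm_le_locally in HP. destruct HP as [d HP].
    unfold filtermap.
    assert (Hd : (0 < d / N)%R) by (apply Rdiv_lt_0_compat; [apply cond_pos|lra]).
    assert (Hloc : locally t (fun s : R => (Rabs (s - t) < d / N)%R)).
    { exists (mkposreal _ Hd). intros s Hs. exact Hs. }
    generalize (filter_and _ _ Hlip Hloc). apply filter_imp.
    intros s [H1 H2]. apply HP. unfold ball_norm.
    eapply Rle_lt_trans; [exact H1|].
    apply (Rmult_lt_compat_l N) in H2; [|exact HN].
    replace (N * (d / N))%R with (pos d) in H2 by (field; lra). exact H2. }
  specialize (Hdom (g t) (fun P HP => HP) (mkposreal _ He1)).
  apply Hcont in Hdom. unfold filtermap in Hdom.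
  generalize (filter_and _ _ Hdom (filter_and _ _ Hlip (Hg (mkposreal _ He2)))).
  apply filter_imp. intros s [H1 [H2 H3]]. cbn [pos] in H1, H3.
  assert (E : f (g s) - f (g t) - RtoC (s - t) * df dg =
    Cplus (minus (minus (f (g s)) (f (g t))) (df (minus (g s) (g t))))
         (df (minus (minus (g s) (g t)) (scal (RtoC (s - t)) dg)))).
  { assert (El : df (minus (minus (g s) (g t)) (scal (RtoC (s - t)) dg)) =
       minus (df (minus (g s) (g t))) (scal (RtoC (s - t)) (df dg))).
    { unfold minus at 1. rewrite (linear_plus _ Hlin).
      rewrite (linear_opp _ _ Hlin), (linear_scal _ Hlin). reflexivity. }
    rewrite El. unfold minus, plus, opp, scal; simpl. unfold mult; simpl. ring. }
  rewrite E.
  eapply Rle_trans; [apply Cmod_triangle|].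
  assert (H4 := HMn (minus (minus (g s) (g t)) (scal (RtoC (s - t)) dg))).
  assert (H5 : (eps / (2 * N) * norm (minus (g s) (g t))
                 <= eps / (2 * N) * (N * Rabs (s - t)))%R)
    by (apply Rmult_le_compat_l; lra).
  assert (H6 : (M * norm (minus (minus (g s) (g t)) (scal (RtoC (s - t)) dg))
                 <= M * (eps / (2 * M) * Rabs (s - t)))%R)
    by (apply Rmult_le_compat_l; lra).
  replace (eps / (2 * N) * (N * Rabs (s - t)))%R
    with (eps / 2 * Rabs (s - t))%R in H5 by (field; lra).
  replace (M * (eps / (2 * M) * Rabs (s - t)))%R
    with (eps / 2 * Rabs (s - t))%R in H6 by (field; lra).
  eapply Rle_trans; [apply Rplus_le_compat; [exact H1|exact H4]|]. lra.
Qed.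

Lemma is_derive_RC_C_comp (f : C -> C) (g : R -> C) (t : R) (df dg : C) :
  is_derive (K := C_AbsRing) (V := C_NormedModule) f (g t) df ->
  is_derive_RC g t dg ->
  is_derive_RC (fun s => f (g s)) t (df * dg).
Proof.
  intros Hf Hg. rewrite Cmult_comm.
  apply (is_derive_RC_chain (AbsRing_NormedModule C_AbsRing) f
           (fun y => y * df) g t dg); [exact Hf|].
  apply is_derive_RC_eps. exact Hg.
Qed.

Lemma is_derive_RC_C2_comp (f : C2 -> C) (df : C2 -> C) (g : R -> C2)
    (t : R) (d1 d3 : C) :
  filterdiff (V := C_NormedModule) f (locally (g t)) df ->
  is_derive_RC (fun s => fst (g s)) t d1 ->
  is_derive_RC (fun s => snd (g s)) t d3 ->
  is_derive_RC (fun s => f (g s)) t (df (d1, d3)).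
Proof.
  intros Hf H1 H3. apply (is_derive_RC_chain C2 f df g t (d1, d3) Hf).
  intros eps.
  assert (He : (0 < eps / 2)%R) by (apply Rdiv_lt_0_compat; [apply cond_pos|lra]).
  generalize (filter_and _ _
    (proj1 (is_derive_RC_eps _ _ _) H1 (mkposreal _ He))
    (proj1 (is_derive_RC_eps _ _ _) H3 (mkposreal _ He))).
  apply filter_imp. intros s [A B]. cbn [pos] in A, B.
  set (v := minus (minus (g s) (g t)) (scal (RtoC (s - t)) (d1, d3))).
  assert (Hv : (norm v <= Cmod (fst v) + Cmod (snd v))%R).
  { change (norm v) with (sqrt (Cmod (fst v) ^ 2 + Cmod (snd v) ^ 2)).
    pose proof (Cmod_ge_0 (fst v)). pose proof (Cmod_ge_0 (snd v)).
    rewrite <- (sqrt_pow2 (Cmod (fst v) + Cmod (snd v))) by lra.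
    apply sqrt_le_1_alt. nra. }
  change (fst v) with (fst (g s) - fst (g t) - RtoC (s - t) * d1) in Hv.
  change (snd v) with (snd (g s) - snd (g t) - RtoC (s - t) * d3) in Hv.
  eapply Rle_trans; [exact Hv|].
  eapply Rle_trans; [exact (Rplus_le_compat _ _ _ _ A B)|]. lra.
Qed.

Lemma is_derive_RC_neq_0_near (f : R -> C) (t : R) (df : C) :
  is_derive_RC f t df -> f t <> 0 -> locally t (fun s => f s <> 0).
Proof.
  intros H%is_derive_RC_continuous Hf.
  assert (Hpos : (0 < Rmax (Rabs (fst (f t))) (Rabs (snd (f t))))%R).
  { apply Rnot_le_lt. intros L. apply Hf.
    pose proof (Rmax_l (Rabs (fst (f t))) (Rabs (snd (f t)))).
    pose proof (Rmax_r (Rabs (fst (f t))) (Rabs (snd (f t)))).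
    apply injective_projections; simpl; apply Rabs_eq_0; apply Rle_antisym;
      try apply Rabs_pos; lra. }
  assert (L := H _ (locally_ball (f t) (mkposreal _ Hpos))).
  unfold filtermap in L. revert L. apply filter_imp. intros s [B1 B2] E.
  change (Rabs (fst (f s) - fst (f t)) <
    Rmax (Rabs (fst (f t))) (Rabs (snd (f t))))%R in B1.
  change (Rabs (snd (f s) - snd (f t)) <
    Rmax (Rabs (fst (f t))) (Rabs (snd (f t))))%R in B2.
  rewrite E in B1, B2. simpl in B1, B2.
  rewrite Rabs_minus_sym, Rminus_0_r in B1, B2.
  apply (Rlt_irrefl (Rmax (Rabs (fst (f t))) (Rabs (snd (f t))))).
  now apply Rmax_lub_lt.
Qed.

(** * Quotient groups *)

(** A class is a predicate with a proof that it is a coset, so equality of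
    classes needs extensionality and proof irrelevance. *)
Lemma proj_eq_iff {G : AbelianGroup} (S : G -> Prop) (u v : G) :
  proj (generated S) u = proj (generated S) v <-> generated S (minus u v).
Proof.
  split.
  - intros [= E]. change (coset (generated S) v u). rewrite <- E.
    unfold coset. rewrite minus_eq_zero. apply generated_zero.
  - intros H.
    assert (E : coset (generated S) u = coset (generated S) v).
    { apply functional_extensionality. intros w.
      apply propositional_extensionality. unfold coset. split; intros Hw.
      - rewrite (minus_trans u). now apply generated_plus.
      - rewrite (minus_trans v). apply generated_plus; [easy|].
        rewrite <- opp_minus. now apply generated_opp. }
    unfold proj.
    generalize (ex_intro (fun x => coset (generated S) u = coset (generated S) x)
                  u eq_refl).
    rewrite E. intros e. f_equal. apply proof_irrelevance.
Qed.

Lemma qplus_proj {G : AbelianGroup} (S : G -> Prop) (u v : G) :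
  qplus (proj (generated S) u) (proj (generated S) v) =
  proj (generated S) (plus u v).
Proof.
  assert (R : forall w, generated S (minus (repr (proj (generated S) w)) w)).
  { intros w. unfold repr.
    destruct (constructive_indefinite_description _ _) as [w' E]. simpl in *.
    rewrite <- opp_minus. apply generated_opp.
    change (coset (generated S) w' w). rewrite <- E.
    unfold coset. rewrite minus_eq_zero. apply generated_zero. }
  unfold qplus. apply proj_eq_iff.
  set (u' := repr (proj _ u)) in *. set (v' := repr (proj _ v)) in *.
  replace (minus (plus u' v') (plus u v)) with (plus (minus u' u) (minus v' v)).
  { apply generated_plus; apply R. }
  unfold minus. rewrite opp_plus, !plus_assoc. f_equal.
  rewrite <- !plus_assoc. f_equal. apply plus_comm.
Qed.

(** * Reparametrized and reversed paths *)

Lemma locally_affine (p q t : R) (P : R -> Prop) :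
  locally (p * t + q)%R P -> locally t (fun s => P (p * s + q)%R).
Proof.
  intros H.
  apply (continuous_plus (K := R_AbsRing) (V := R_NormedModule)
           (fun s => p * s)%R (fun _ => q) t); [| |exact H].
  - apply (continuous_scal_r (K := R_AbsRing) (V := R_NormedModule) p (fun s => s) t).
    apply continuous_id.
  - apply continuous_const.
Qed.

Lemma C1_near_affine (p q t : R) (a a' : R -> C) :
  C1_near a a' (p * t + q)%R ->
  C1_near (fun s => a (p * s + q)%R) (fun s => RtoC p * a' (p * s + q)%R) t.
Proof.
  intros H. apply (locally_affine p q t) in H. unfold C1_near.
  revert H. apply filter_imp. intros s [Hd Hc].
  assert (L : is_derive (fun s => p * s + q)%R s p).
  { auto_derive; [easy|ring]. }
  split.
  - apply (is_derive_RC_eq _ _ (scal p (a' (p * s + q)%R))).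
    + exact (is_derive_comp (K := R_AbsRing) (V := C_R_NormedModule)
               a (fun s => p * s + q)%R s _ p Hd L).
    + apply injective_projections; simpl; unfold scal; simpl;
        unfold mult; simpl; ring.
  - apply (continuous_ext (fun s => scal (K := R_AbsRing)
             (V := C_R_NormedModule) p (a' (p * s + q)%R))).
    { intros y. apply injective_projections; simpl; unfold scal; simpl;
        unfold mult; simpl; ring. }
    apply (continuous_scal_r (K := R_AbsRing) (V := C_R_NormedModule)).
    apply (continuous_comp (U := R_UniformSpace) (V := R_UniformSpace)
             (W := C_UniformSpace) (fun s => p * s + q)%R a').
    + apply (ex_derive_continuous (K := R_AbsRing) (V := R_NormedModule)).
      now exists p.
    + exact Hc.
Qed.

Lemma path_coords_affine (X : hcurve) (g : R -> point) (p q t : R) (k : chart)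
    (a b a' b' : R -> C) :
  path_coords X g (p * t + q)%R k a b a' b' ->
  path_coords X (fun s => g (p * s + q)%R) t k
    (fun s => a (p * s + q)%R) (fun s => b (p * s + q)%R)
    (fun s => RtoC p * a' (p * s + q)%R) (fun s => RtoC p * b' (p * s + q)%R).
Proof.
  intros [H [Ha Hb]]. split; [|split; now apply C1_near_affine].
  exact (locally_affine p q t _ H).
Qed.

Lemma form_value_scal (X : hcurve) (w : hform) (k : chart)
    (a b da db c p : C) :
  form_value X w k a b da db c ->
  form_value X w k a b (p * da) (p * db) (p * c).
Proof.
  intros [H1 H2]. split.
  - transitivity (p * (2 * b * c)); [ring|]. rewrite H1. ring.
  - intros d Hd. transitivity (p * (d * c)); [ring|]. rewrite (H2 d Hd). ring.
Qed.

Lemma C1_arc_affine (X : hcurve) (g : R -> point) (p q : R) :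
  (forall t, 0 <= t <= 1 -> 0 <= p * t + q <= 1)%R ->
  C1_arc X g -> C1_arc X (fun t => g (p * t + q)%R).
Proof.
  intros Hpq Hg t Ht.
  destruct (Hg _ (Hpq t Ht)) as (k & a & b & a' & b' & H).
  do 5 eexists. exact (path_coords_affine X g p q t k a b a' b' H).
Qed.

(** The accumulator lets one induction handle reversal and concatenation, and
    avoids asking whether the intermediate points lie on the curve. *)
Definition reverse_onto (l acc : path) : path :=
  fold_left (fun acc g => (fun t : R => g (-1 * t + 1)%R) :: acc) l acc.

Lemma is_path_reverse_onto (X : hcurve) (l acc : path) (P Q S : point) :
  is_path X P l Q -> is_path X P acc S -> is_path X Q (reverse_onto l acc) S.
Proof.
  revert P acc. induction l as [|g l IH]; intros P acc Hl Hacc; simpl in *.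
  - destruct Hl as [_ <-]. exact Hacc.
  - destruct Hl as [Hg [HP Hl]]. apply (IH (g 1%R)); [exact Hl|].
    simpl. split; [|split].
    + apply C1_arc_affine; [intros; lra|exact Hg].
    + f_equal; ring.
    + replace (-1 * 1 + 1)%R with 0%R by ring. now rewrite HP.
Qed.

Lemma is_arc_integral_reverse (X : hcurve) (w : hform) (g : R -> point) (v : C) :
  is_arc_integral X w g v ->
  is_arc_integral X w (fun t => g (-1 * t + 1)%R) (- v).
Proof.
  intros [c [Hc Hv]]. exists (fun t => RtoC (-1) * c (-1 * t + 1)%R). split.
  - intros t Ht. destruct (Hc (-1 * t + 1)%R ltac:(lra))
      as (k & a & b & a' & b' & Hp & Hf).
    do 5 eexists. split; [exact (path_coords_affine X g _ _ t k a b a' b' Hp)|].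
    now apply form_value_scal.
  - apply (is_RInt_ext (V := C_R_NormedModule)
             (fun t => scal (-1)%R (c (-1 * t + 1)%R))).
    { intros t _. apply injective_projections; simpl; unfold scal; simpl;
        unfold mult; simpl; ring. }
    apply (is_RInt_comp_lin (V := C_R_NormedModule)).
    replace (-1 * 0 + 1)%R with 1%R by ring.
    replace (-1 * 1 + 1)%R with 0%R by ring.
    exact (is_RInt_swap (V := C_R_NormedModule) _ _ _ _ Hv).
Qed.

Lemma is_path_integral_reverse_onto (X : hcurve) (w : hform) (l acc : path)
    (v v' : C) :
  is_path_integral X w l v -> is_path_integral X w acc v' ->
  is_path_integral X w (reverse_onto l acc) (v' - v).
Proof.
  revert v acc v'. induction l as [|g l IH]; intros v acc v' Hl Hacc; simpl in *.
  - subst v. now replace (v' - 0) with v' by ring.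
  - destruct Hl as (v1 & v2 & H1 & H2 & ->).
    replace (v' - (v1 + v2)) with ((- v1 + v') - v2) by ring.
    apply IH; [exact H2|]. simpl. exists (- v1), v'.
    split; [now apply is_arc_integral_reverse|]. now split.
Qed.

(** * Independence of the path modulo periods *)

(** The arbitrary path chosen in the definition of [abel_jacobi] and the path
    [l] have the same endpoints; going back along one and forth along the other
    is a closed path, whose integral is a period. *)
Lemma abel_jacobi_eq (X : hcurve) {G : AbelianGroup} (Int : path -> G -> Prop)
    (O P : point) (l : path) (v : G) :
  (forall l1 l2 v1 v2, Int l1 v1 -> Int l2 v2 ->
     Int (reverse_onto l1 l2) (minus v2 v1)) ->
  is_path X O l P -> Int l v ->
  abel_jacobi X Int O P = proj (periods X Int) v.
Proof.
  intros Hrev Hl Hv. unfold abel_jacobi.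
  set (v' := epsilon _ _).
  assert (H : exists l, is_path X O l P /\ Int l v').
  { apply (epsilon_spec (inhabits zero)
             (fun v => exists l, is_path X O l P /\ Int l v)).
    now exists v, l. }
  destruct H as [l' [Hl' Hv']].
  apply proj_eq_iff. apply generated_in. exists P, (reverse_onto l l'). split.
  - now apply (is_path_reverse_onto _ _ _ O).
  - now apply Hrev.
Qed.

Lemma J_map_eq (lambda : C) (P : point) (l : path) (v : C) :
  is_path (legendre lambda) Inf l P -> Omega_integral lambda l v ->
  J_map lambda P = projE lambda v.
Proof.
  intros Hl Hv. apply (abel_jacobi_eq _ _ _ _ l v); [|exact Hl|exact Hv].
  intros l1 l2 v1 v2 H1 H2. now apply is_path_integral_reverse_onto.
Qed.

Lemma I_map_eq (alpha beta : C) (O P : point) (l : path) (v : C2) :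
  is_path (curveV alpha beta) O l P -> omega_integral alpha beta l v ->
  I_map alpha beta O P = projV alpha beta v.
Proof.
  intros Hl Hv. apply (abel_jacobi_eq _ _ _ _ l v); [|exact Hl|exact Hv].
  intros l1 l2 v1 v2 [H1 H1'] [H2 H2'].
  split; now apply is_path_integral_reverse_onto.
Qed.

(** * Translations of a Legendre curve *)

(** The chord formula for the sum of [(x1, y1)] and the point with coordinates
    [(s, w)] at infinity has a pole at [(0, 0)].  After the relation
    [w^2 = s (1 - s) (1 - lambda s)] is used to cancel it, one obtains
    [translate_x] and [translate_y], which are regular there and take the value
    [(x1, y1)]. *)
Definition translate_x (lambda x1 y1 s w : C) : C :=
  (1 + lambda - x1) +
  (- (1 + lambda) + 2 * x1 - 2 * w * y1 + (lambda - x1 * x1) * s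
     + y1 * y1 * (s * s)) / ((1 - x1 * s) * (1 - x1 * s)).

Definition translate_y (lambda x1 y1 s w : C) : C :=
  - (y1 + (- 2 * y1 * ((1 - s) * (1 - lambda * s)) + 2 * w * (y1 * y1) * s +
     (w - y1 * (s * s)) *
     ((1 + lambda - 2 * x1) * (- 2 * x1 + x1 * x1 * s) + (lambda - x1 * x1)
       + y1 * y1 * s))
     / ((1 - x1 * s) * (1 - x1 * s) * (1 - x1 * s))).

Lemma legendre_infinity_chart (lambda s w : C) :
  on_chart (legendre lambda) Infinity_chart s w ->
  w * w = s * ((1 - s) * (1 - lambda * s)).
Proof.
  unfold on_chart; simpl. intros H.
  transitivity (w * (w * 1)); [ring|]. rewrite H. ring.
Qed.

Lemma legendre_infinity_chart_zero (lambda w : C) :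
  on_chart (legendre lambda) Infinity_chart 0 w -> w = 0.
Proof.
  intros H%legendre_infinity_chart.
  destruct (Ceq_dec w 0) as [E|E]; [exact E|].
  exfalso. apply (Cmult_neq_0 _ _ E E). rewrite H. ring.
Qed.

(** The slope of the chord is [(w - y1 s^2) / (s (1 - x1 s))]; the relation
    [w^2 = s (1 - s) (1 - lambda s)] makes the numerators of [m^2 - 1/s] and of
    [m (x3 - x1)] divisible by the powers of [s] in the denominators. *)
Lemma legendre_add_near_Inf (lambda x1 y1 s w : C) :
  on_chart (legendre lambda) Infinity_chart s w -> 1 - x1 * s <> 0 ->
  legendre_add lambda (Aff x1 y1)
    (chart_point (legendre lambda) Infinity_chart s w) =
  Aff (translate_x lambda x1 y1 s w) (translate_y lambda x1 y1 s w).
Proof.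
  intros Hc Hs. unfold chart_point.
  destruct (Ceq_dec s 0) as [->|Hs0].
  (* At infinity itself the sum is [(x1, y1)]. *)
  - apply legendre_infinity_chart_zero in Hc. subst w.
    unfold legendre_add, translate_x, translate_y. f_equal; field.
  - apply legendre_infinity_chart in Hc.
    assert (Hn : x1 <> / s).
    { intros ->. apply Hs. now field. }
    cbn [legendre hgenus]. unfold legendre_add.
    destruct (Ceq_dec x1 (/ s)) as [E|_]; [easy|]. cbv zeta.
    assert (Hd : / s - x1 <> 0).
    { intros E. apply Hn. symmetry. transitivity (/ s - x1 + x1); [ring|].
      rewrite E. ring. }
    set (m := (w / s ^ 2 - y1) / (/ s - x1)).
    assert (Hm : m = (w - y1 * (s * s)) / (s * (1 - x1 * s))).
    { unfold m. field. repeat split; try easy. }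
    assert (Hm2 : m ^ 2 - / s =
       (- (1 + lambda) + 2 * x1 - 2 * w * y1 + (lambda - x1 * x1) * s
         + y1 * y1 * (s * s)) / ((1 - x1 * s) * (1 - x1 * s))).
    { rewrite Hm.
      transitivity ((w * w - 2 * w * y1 * (s * s) + y1 * y1 * (s * s * (s * s))
        - s * ((1 - x1 * s) * (1 - x1 * s))) / (s * s * ((1 - x1 * s) * (1 - x1 * s)))).
      { field. now split. }
      rewrite Hc. field. now split. }
    assert (Hx : m ^ 2 + (1 + lambda) - x1 - / s = translate_x lambda x1 y1 s w).
    { unfold translate_x. rewrite <- Hm2. ring. }
    rewrite Hx. f_equal. unfold translate_y. f_equal. f_equal.
    rewrite Hm. unfold translate_x.
    transitivity (((- 2 * y1) * (w * w) / s + 2 * w * (y1 * y1) * s +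
     (w - y1 * (s * s)) *
     ((1 + lambda - 2 * x1) * (- 2 * x1 + x1 * x1 * s) + (lambda - x1 * x1)
       + y1 * y1 * s)) / ((1 - x1 * s) * (1 - x1 * s) * (1 - x1 * s))).
    { field. now split. }
    rewrite Hc. field. now split.
Qed.

(** Differentiates an expression by its head symbol; matching on the syntax
    prevents unification from unfolding the complex operations. *)
Ltac derive_RC :=
  lazymatch goal with
  | |- is_derive (fun _ => ?c) ?t _ => exact (is_derive_RC_const c t)
  | |- is_derive (fun s => Cplus (@?f s) (@?g s)) ?t _ =>
      eapply (is_derive_RC_plus f g t); derive_RC
  | |- is_derive (fun s => Cminus (@?f s) (@?g s)) ?t _ =>
      eapply (is_derive_RC_minus f g t); derive_RC
  | |- is_derive (fun s => Copp (@?f s)) ?t _ =>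
      eapply (is_derive_RC_opp f t); derive_RC
  | |- is_derive (fun s => Cmult (@?f s) (@?g s)) ?t _ =>
      eapply (is_derive_RC_mult f g t); derive_RC
  | |- is_derive (fun s => Cdiv (@?f s) (@?g s)) ?t _ =>
      eapply (is_derive_RC_div f g t); [try eassumption|derive_RC|derive_RC]
  | |- is_derive (fun s => RtoC s) ?t _ => exact (is_derive_RC_id t)
  | |- _ => try eassumption
  end.

(** Invariance of [Omega]: at infinity [Omega] is [dw], and at the translated
    point it is [- dX/2Y], equal to [- dY/f'(X)].  The coordinate [s] has
    derivative 0 because it vanishes to order two at infinity. *)
Lemma is_derive_translate (lambda x1 y1 : C) (S W : R -> C) (t : R) (c : C) :
  S t = 0 -> W t = 0 -> is_derive_RC S t (RtoC 0) -> is_derive_RC W t c ->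
  is_derive_RC (fun s => translate_x lambda x1 y1 (S s) (W s)) t (- 2 * y1 * c) /\
  is_derive_RC (fun s => translate_y lambda x1 y1 (S s) (W s)) t
    (- (3 * x1 * x1 - 2 * (1 + lambda) * x1 + lambda) * c).
Proof.
  intros S0 W0 HS HW.
  assert (N : 1 - x1 * S t <> 0).
  { rewrite S0. intros E. apply C1_nz. rewrite <- E. ring. }
  assert (N2 := Cmult_neq_0 _ _ N N). assert (N3 := Cmult_neq_0 _ _ N2 N).
  unfold translate_x, translate_y. split.
  - eapply is_derive_RC_eq; [derive_RC|].
    cbv beta. rewrite S0, W0. field.
  - eapply is_derive_RC_eq; [derive_RC|].
    cbv beta. rewrite S0, W0. field.
Qed.

(** * Homomorphisms from the plane to a Legendre curve *)

(** A homomorphism to a Legendre curve with complex differentiable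
    coordinates at 0, where [A u_1 + B u_3] is the pullback of [Omega] at 0. *)
Record hom_from_C2 (lambda : C) (G : C2 -> point) (A B : C) : Prop := {
  hom_on_curve : forall u, on_curve (legendre lambda) (G u);
  hom_add : forall u v, G (plus u v) = legendre_add lambda (G u) (G v);
  hom_chart : exists (a b la lb : C2 -> C),
    locally (zero : C2) (fun v : C2 =>
      on_chart (legendre lambda) Infinity_chart (a v) (b v) /\
      G v = chart_point (legendre lambda) Infinity_chart (a v) (b v)) /\
    filterdiff (V := C_NormedModule) a (locally (zero : C2)) la /\
    filterdiff (V := C_NormedModule) b (locally (zero : C2)) lb /\
    forall u : C2, lb u = A * fst u + B * snd u }.

(** If [P] is affine and [P + P = P], the chord-tangent formula gives the
    ordinate [- y] to [P + P], so [y = 0]; but then [P + P] is at infinity. *)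
Lemma legendre_idempotent (lambda : C) (P : point) :
  P = legendre_add lambda P P -> P = Inf.
Proof.
  destruct P as [x y|]; [|easy]. unfold legendre_add; intros H.
  destruct (Ceq_dec x x) as [_|N]; [|easy].
  destruct (Ceq_dec (y + y) 0) as [E|E]; [easy|]. exfalso. cbv zeta in H.
  set (m := (_ / _)) in H. set (x3 := m ^ 2 + (1 + lambda) - x - x) in H.
  injection H as Hx Hy. apply E. rewrite <- Hx in Hy.
  rewrite Hy at 1. ring.
Qed.

Lemma linear_C2 (l : C2 -> C) (u : C2) :
  is_linear (V := C_NormedModule) l ->
  l u = l (RtoC 1, RtoC 0) * fst u + l (RtoC 0, RtoC 1) * snd u.
Proof.
  intros H.
  assert (E : u = plus (scal (K := C_AbsRing) (V := C2) (fst u) ((RtoC 1, RtoC 0) : C2))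
                       (scal (K := C_AbsRing) (V := C2) (snd u) ((RtoC 0, RtoC 1) : C2))).
  { assert (E1 : forall x y : C, x = x * 1 + y * 0) by (intros; ring).
    assert (E2 : forall x y : C, y = x * 0 + y * 1) by (intros; ring).
    exact (injective_projections u (_, _) (E1 _ _) (E2 _ _)). }
  rewrite E at 1. rewrite (linear_plus _ H), !(linear_scal _ H).
  apply f_equal2; apply Cmult_comm.
Qed.

(** The image of 0 is at infinity, so the chart around it can only be the
    chart at infinity. *)
Lemma holomorphic_hom_lift (alpha beta lambda : C)
    (F : JacV alpha beta -> point) :
  holomorphic_hom alpha beta lambda F ->
  exists A B, hom_from_C2 lambda (fun u => F (projV alpha beta u)) A B.
Proof.
  intros [Hon [Hadd Hhol]].
  assert (Hadd' : forall u v : C2, F (projV alpha beta (plus u v)) =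
    legendre_add lambda (F (projV alpha beta u)) (F (projV alpha beta v))).
  { intros u v. rewrite <- Hadd. unfold projV, periods.
    now rewrite (qplus_proj (G := C2)). }
  assert (H0 : F (projV alpha beta zero) = Inf).
  { apply (legendre_idempotent lambda). rewrite <- Hadd'.
    now rewrite (plus_zero_l (G := C2)). }
  destruct (Hhol zero) as (k & a & b & Hloc & Ha & Hb).
  assert (k = Infinity_chart) as ->.
  { apply locally_singleton in Hloc. destruct Hloc as [_ E].
    rewrite H0 in E. destruct k; [discriminate E|reflexivity]. }
  apply locally_singleton in Ha. apply locally_singleton in Hb.
  destruct Ha as [la Ha]. destruct Hb as [lb Hb].
  exists (lb (RtoC 1, RtoC 0)), (lb (RtoC 0, RtoC 1)).
  split; [intros u; apply Hon|exact Hadd'|].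
  exists a, b, la, lb. split; [exact Hloc|]. split; [exact Ha|].
  split; [exact Hb|]. intros u. apply linear_C2. exact (proj1 Hb).
Qed.

Lemma locally_C2_path (U : R -> C2) (t : R) (d1 d3 : C) (P : C2 -> Prop) :
  is_derive_RC (fun s => fst (U s)) t d1 ->
  is_derive_RC (fun s => snd (U s)) t d3 ->
  locally (U t) P -> locally t (fun s => P (U s)).
Proof.
  intros H1%is_derive_RC_continuous H3%is_derive_RC_continuous [e He].
  assert (L1 := H1 _ (locally_ball (fst (U t)) e)).
  assert (L3 := H3 _ (locally_ball (snd (U t)) e)).
  unfold filtermap in L1, L3. generalize (filter_and _ _ L1 L3). apply filter_imp.
  intros s [B1 B3]. apply He. split; assumption.
Qed.

Lemma hom_zero (lambda A B : C) (G : C2 -> point) :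
  hom_from_C2 lambda G A B -> G zero = Inf.
Proof.
  intros HG. apply (legendre_idempotent lambda).
  rewrite <- (hom_add _ _ _ _ HG). f_equal.
  symmetry. apply (plus_zero_l (G := C2)).
Qed.

(** [G (U s) = G (U t) + G (U s - U t)], and [U s - U t] is close to 0.  The
    equation of the curve, differentiated at [(0, 0)], forces [S' = 0]. *)
Lemma hom_near_zero (lambda : C) (G : C2 -> point) (A B : C)
    (U : R -> C2) (t : R) (d1 d3 c : C) :
  hom_from_C2 lambda G A B -> A * d1 + B * d3 = c ->
  is_derive_RC (fun s => fst (U s)) t d1 ->
  is_derive_RC (fun s => snd (U s)) t d3 ->
  exists S W : R -> C,
    S t = 0 /\ W t = 0 /\
    is_derive_RC S t (RtoC 0) /\ is_derive_RC W t c /\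
    locally t (fun s =>
      on_chart (legendre lambda) Infinity_chart (S s) (W s) /\
      G (U s) = legendre_add lambda (G (U t))
        (chart_point (legendre lambda) Infinity_chart (S s) (W s))).
Proof.
  intros HG <- H1 H3.
  destruct (hom_chart _ _ _ _ HG) as (a & b & la & lb & Hloc & Ha & Hb & Hlb).
  set (V := fun s => minus (U s) (U t)).
  assert (V1 : is_derive_RC (fun s => fst (V s)) t d1).
  { apply (is_derive_RC_eq _ _ (d1 - 0)); [|ring].
    apply (is_derive_RC_minus (fun s => fst (U s)) (fun _ => fst (U t)));
      [exact H1|apply is_derive_RC_const]. }
  assert (V3 : is_derive_RC (fun s => snd (V s)) t d3).
  { apply (is_derive_RC_eq _ _ (d3 - 0)); [|ring].
    apply (is_derive_RC_minus (fun s => snd (U s)) (fun _ => snd (U t)));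
      [exact H3|apply is_derive_RC_const]. }
  assert (V0 : V t = zero) by apply (minus_eq_zero (G := C2)).
  assert (Hl : locally t (fun s =>
      on_chart (legendre lambda) Infinity_chart (a (V s)) (b (V s)) /\
      G (V s) = chart_point (legendre lambda) Infinity_chart (a (V s)) (b (V s)))).
  { apply (locally_C2_path V t d1 d3 (fun v =>
      on_chart (legendre lambda) Infinity_chart (a v) (b v) /\
      G v = chart_point (legendre lambda) Infinity_chart (a v) (b v)) V1 V3).
    rewrite V0. exact Hloc. }
  assert (Ha' : filterdiff (V := C_NormedModule) a (locally (V t)) la)
    by (rewrite V0; exact Ha).
  assert (Hb' : filterdiff (V := C_NormedModule) b (locally (V t)) lb)
    by (rewrite V0; exact Hb).
  pose proof (is_derive_RC_C2_comp a la V t d1 d3 Ha' V1 V3) as DS.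
  pose proof (is_derive_RC_C2_comp b lb V t d1 d3 Hb' V1 V3) as DW.
  rewrite Hlb in DW. simpl in DW.
  assert (S0 : a (V t) = 0).
  { apply locally_singleton in Hl. destruct Hl as [_ E].
    assert (E0 : G (V t) = Inf) by (rewrite V0; exact (hom_zero _ _ _ _ HG)).
    rewrite E0 in E. unfold chart_point in E.
    destruct (Ceq_dec (a (V t)) 0); [easy|discriminate E]. }
  assert (W0 : b (V t) = 0).
  { apply locally_singleton in Hl. destruct Hl as [E _].
    rewrite S0 in E. exact (legendre_infinity_chart_zero _ _ E). }
  (* Differentiate [w^2 = s (1 - s) (1 - lambda s)] at [(0, 0)]:
       the left side has derivative 0 and the right side [S']. *)
  assert (DS0 : la (d1, d3) = 0).
  { set (c := la (d1, d3)) in *. set (e := A * d1 + B * d3) in *.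
    assert (E1 : is_derive_RC (fun s => b (V s) * b (V s)) t (RtoC 0)).
    { eapply is_derive_RC_eq; [exact (is_derive_RC_mult _ _ t _ _ DW DW)|].
      cbv beta. rewrite W0. ring. }
    assert (E2 : is_derive_RC
      (fun s => a (V s) * ((1 - a (V s)) * (1 - lambda * a (V s)))) t c).
    { eapply is_derive_RC_eq; [derive_RC|]. cbv beta. rewrite S0. ring. }
    symmetry. apply (is_derive_RC_unique _ t _ _ E1).
    revert E2. apply is_derive_RC_ext_loc; [|reflexivity].
    revert Hl. apply filter_imp. intros s [E _].
    symmetry. now apply legendre_infinity_chart. }
  rewrite DS0 in DS.
  exists (fun s => a (V s)), (fun s => b (V s)).
  repeat (split; [assumption|]).
  revert Hl. apply filter_imp. intros s [E E']. split; [exact E|].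
  rewrite <- E', <- (hom_add _ _ _ _ HG). f_equal. unfold V, minus.
  rewrite (plus_comm (G := C2)), <- (plus_assoc (G := C2)), (plus_opp_l (G := C2)).
  symmetry. apply (plus_zero_r (G := C2)).
Qed.

(** Translation by [G (U t)] carries the derivative of [G] at 0 to the point
    [U t]. *)
Lemma hom_near_affine (lambda : C) (G : C2 -> point) (A B : C)
    (U : R -> C2) (t : R) (d1 d3 c x1 y1 : C) :
  hom_from_C2 lambda G A B -> A * d1 + B * d3 = c ->
  is_derive_RC (fun s => fst (U s)) t d1 ->
  is_derive_RC (fun s => snd (U s)) t d3 ->
  G (U t) = Aff x1 y1 ->
  exists X Y : R -> C,
    is_derive_RC X t (- 2 * y1 * c) /\
    is_derive_RC Y t
      (- (3 * x1 * x1 - 2 * (1 + lambda) * x1 + lambda) * c) /\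
    locally t (fun s => G (U s) = Aff (X s) (Y s)).
Proof.
  intros HG Hc H1 H3 Ht.
  destruct (hom_near_zero lambda G A B U t d1 d3 c HG Hc H1 H3)
    as (S & W & S0 & W0 & DS & DW & Hl).
  destruct (is_derive_translate lambda x1 y1 S W t _ S0 W0 DS DW) as [DX DY].
  do 2 eexists. split; [exact DX|]. split; [exact DY|].
  assert (N : locally t (fun s => 1 - x1 * S s <> 0)).
  { apply is_derive_RC_neq_0_near with (df := RtoC 0 - (0 * S t + x1 * 0)).
    - derive_RC.
    - rewrite S0. intros E. apply C1_nz. rewrite <- E. ring. }
  generalize (filter_and _ _ N Hl). apply filter_imp.
  intros s [Hs [Hon Hg]]. rewrite Hg, Ht. now apply legendre_add_near_Inf.
Qed.

(** * Integrating along the image of a line *)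

Lemma is_derive_RC_rhs_unique (X : hcurve) (k : chart) (a d d' : C) :
  is_derive (K := C_AbsRing) (V := C_NormedModule) (rhs X k) a d ->
  is_derive_RC (fun s => rhs X k (a + RtoC s)) 0 d' ->
  d = d'.
Proof.
  intros Hd Hd'.
  apply (is_derive_RC_unique (fun s => rhs X k (a + RtoC s)) 0 d d'); [|exact Hd'].
  apply (is_derive_RC_eq _ _ (d * (0 + 1))); [|ring].
  apply (is_derive_RC_C_comp (rhs X k) (fun s => a + RtoC s)).
  - now replace (a + RtoC 0) with a by ring.
  - apply (is_derive_RC_plus (fun _ => a) (fun s => RtoC s));
      [apply is_derive_RC_const|apply is_derive_RC_id].
Qed.

Lemma Cinv_nonzero (z : C) : z <> 0 -> / z <> 0.
Proof.
  intros Hz E. apply C1_nz. rewrite <- (Cinv_r z Hz), E. ring.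
Qed.

Definition affine_x (P : point) : C := match P with Aff x _ => x | Inf => 0 end.
Definition affine_y (P : point) : C := match P with Aff _ y => y | Inf => 0 end.

(** The coordinates [s = 1/x] and [w = y/x^2], extended by 0 to the point at
    infinity. *)
Definition infinity_s (P : point) : C :=
  match P with Aff x _ => / x | Inf => 0 end.
Definition infinity_w (P : point) : C :=
  match P with Aff x y => y / (x * x) | Inf => 0 end.

Definition in_infinity_chart (P : point) : Prop :=
  match P with Aff x _ => x <> 0 | Inf => True end.

Lemma legendre_finite_chart (lambda x y : C) :
  on_curve (legendre lambda) (Aff x y) ->
  y * y = x * ((x - 1) * (x - lambda)).
Proof.
  unfold on_curve, on_chart; simpl. intros H.
  transitivity (y * (y * 1)); [ring|]. rewrite H. ring.
Qed.

Lemma infinity_coordinates (lambda : C) (P : point) :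
  on_curve (legendre lambda) P -> in_infinity_chart P ->
  on_chart (legendre lambda) Infinity_chart (infinity_s P) (infinity_w P) /\
  P = chart_point (legendre lambda) Infinity_chart (infinity_s P) (infinity_w P).
Proof.
  destruct P as [x y|]; simpl; intros Hc Hx.
  - apply (legendre_finite_chart lambda) in Hc. split.
    + unfold on_chart; simpl.
      transitivity (y * y / (x * x * (x * x))); [field; easy|].
      rewrite Hc. field. easy.
    + assert (Hx' : / x <> 0) by now apply Cinv_nonzero.
      destruct (Ceq_dec (/ x) 0) as [E|_]; [easy|].
      f_equal; field; easy.
  - split; [unfold on_chart; simpl; ring|].
    destruct (Ceq_dec 0 0); easy.
Qed.

Lemma infinity_coordinates_chart_point (lambda s w : C) :
  on_chart (legendre lambda) Infinity_chart s w ->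
  infinity_s (chart_point (legendre lambda) Infinity_chart s w) = s /\
  infinity_w (chart_point (legendre lambda) Infinity_chart s w) = w /\
  in_infinity_chart (chart_point (legendre lambda) Infinity_chart s w).
Proof.
  intros H. unfold chart_point. destruct (Ceq_dec s 0) as [->|Hs].
  - now rewrite (legendre_infinity_chart_zero _ _ H).
  - simpl. split; [now field|]. split; [now field|now apply Cinv_nonzero].
Qed.

Definition line (G : C2 -> point) (u : C2) (s : R) : point :=
  G (RtoC s * fst u, RtoC s * snd u).

Lemma hom_line_derive (u : C2) (t : R) :
  is_derive_RC (fun s : R => fst ((RtoC s * fst u, RtoC s * snd u) : C2)) t (fst u) /\
  is_derive_RC (fun s : R => snd ((RtoC s * fst u, RtoC s * snd u) : C2)) t (snd u).
Proof.
  split; simpl.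
  - apply (is_derive_RC_eq _ _ (1 * fst u + RtoC t * 0));
      [|apply injective_projections; simpl; ring].
    apply (is_derive_RC_mult (fun s => RtoC s) (fun _ => fst u));
      [apply is_derive_RC_id|apply is_derive_RC_const].
  - apply (is_derive_RC_eq _ _ (1 * snd u + RtoC t * 0));
      [|apply injective_projections; simpl; ring].
    apply (is_derive_RC_mult (fun s => RtoC s) (fun _ => snd u));
      [apply is_derive_RC_id|apply is_derive_RC_const].
Qed.

(** The equations [X' = -2 Y c] and [Y' = - f'(X) c]: the right-hand sides are
    again differentiable, so that the coordinates are C^1. *)
Lemma hom_line_affine (lambda A B c : C) (G : C2 -> point) (u : C2) (t : R) :
  hom_from_C2 lambda G A B -> A * fst u + B * snd u = c ->
  line G u t <> Inf ->
  is_derive_RC (fun s => affine_x (line G u s)) t (- 2 * affine_y (line G u t) * c) /\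
  is_derive_RC (fun s => affine_y (line G u s)) t
    (- (3 * affine_x (line G u t) * affine_x (line G u t)
        - 2 * (1 + lambda) * affine_x (line G u t)
        + lambda) * c) /\
  locally t (fun s => line G u s <> Inf).
Proof.
  intros HG Hc Ht. destruct (line G u t) as [x1 y1|] eqn:E; [|easy]. clear Ht.
  destruct (hom_line_derive u t) as [H1 H3].
  destruct (hom_near_affine lambda G A B _ t _ _ c x1 y1 HG Hc H1 H3 E)
    as (X & Y & DX & DY & Hl).
  split; [|split].
  - revert DX. apply is_derive_RC_ext_loc; [|reflexivity].
    revert Hl. apply filter_imp. intros s Hs. unfold line. now rewrite Hs.
  - revert DY. apply is_derive_RC_ext_loc; [|reflexivity].
    revert Hl. apply filter_imp. intros s Hs. unfold line. now rewrite Hs.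
  - revert Hl. apply filter_imp. intros s Hs. unfold line. now rewrite Hs.
Qed.

(** The same equations in the chart at infinity.  At an affine point they
    follow from those for [X] and [Y]; at infinity, from the additivity of
    [G]. *)
Lemma hom_line_infinity (lambda A B c : C) (G : C2 -> point) (u : C2) (t : R) :
  hom_from_C2 lambda G A B -> A * fst u + B * snd u = c ->
  in_infinity_chart (line G u t) ->
  is_derive_RC (fun s => infinity_s (line G u s)) t (2 * infinity_w (line G u t) * c) /\
  is_derive_RC (fun s => infinity_w (line G u s)) t
    ((1 - 2 * (1 + lambda) * infinity_s (line G u t)
      + 3 * lambda * infinity_s (line G u t) * infinity_s (line G u t)) * c) /\
  locally t (fun s => in_infinity_chart (line G u s)).
Proof.
  intros HG Hc Ht. destruct (line G u t) as [x y|] eqn:E.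
  - simpl in Ht. destruct (hom_line_affine lambda A B c G u t HG Hc) as (DX & DY & Hl).
    { now rewrite E. }
    rewrite E in DX, DY. simpl affine_x in DX, DY. simpl affine_y in DX, DY.
    assert (Nx : affine_x (line G u t) <> 0) by now rewrite E.
    assert (Hxy : y * y = x * ((x - 1) * (x - lambda))).
    { apply legendre_finite_chart. rewrite <- E. apply (hom_on_curve _ _ _ _ HG). }
    split; [|split].
    + apply (is_derive_RC_ext_loc (fun s => / affine_x (line G u s)) _ t _ _)
        with (3 := is_derive_RC_inv _ t _ Nx DX).
      * revert Hl. apply filter_imp. intros s Hs. now destruct (line G u s).
      * rewrite E. simpl. field. easy.
    + apply (is_derive_RC_ext_loc
          (fun s => affine_y (line G u s)
                      / (affine_x (line G u s) * affine_x (line G u s))) _ t _ _)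
        with (3 := is_derive_RC_div _ _ t _ _ (Cmult_neq_0 _ _ Nx Nx) DY
                    (is_derive_RC_mult _ _ t _ _ DX DX)).
      * revert Hl. apply filter_imp. intros s Hs. now destruct (line G u s).
      * rewrite E. simpl.
        transitivity
          ((4 * (y * y) * x
              - (3 * x * x - 2 * (1 + lambda) * x + lambda) * (x * x)) * c
             / (x * x * (x * x))).
        { field. easy. }
        rewrite Hxy. field. easy.
    + generalize (filter_and _ _ Hl (is_derive_RC_neq_0_near _ _ _ DX Nx)).
      apply filter_imp. intros s [Hs Hs']. now destruct (line G u s).
  - destruct (hom_line_derive u t) as [H1 H3].
    destruct (hom_near_zero lambda G A B _ t _ _ c HG Hc H1 H3)
      as (S & W & S0 & W0 & DS & DW & Hl).
    assert (Hl' : locally t (fun s => S s = infinity_s (line G u s) /\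
       W s = infinity_w (line G u s) /\ in_infinity_chart (line G u s))).
    { revert Hl. apply filter_imp. intros s [Hon Hs].
      assert (Hs' : line G u s =
        chart_point (legendre lambda) Infinity_chart (S s) (W s)).
      { change (line G u s = legendre_add lambda (line G u t)
          (chart_point (legendre lambda) Infinity_chart (S s) (W s))) in Hs.
        rewrite E in Hs. exact Hs. }
      rewrite Hs'.
      destruct (infinity_coordinates_chart_point _ _ _ Hon) as (-> & -> & H).
      easy. }
    split; [|split].
    + revert DS. apply is_derive_RC_ext_loc; [|simpl; ring].
      revert Hl'. now apply filter_imp.
    + revert DW. apply is_derive_RC_ext_loc; [|simpl; ring].
      revert Hl'. now apply filter_imp.
    + revert Hl'. now apply filter_imp.
Qed.

(** The pullback of [Omega] to the line is constant. *)
Lemma hom_line_coords (lambda A B c : C) (G : C2 -> point) (u : C2) (t : R) :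
  hom_from_C2 lambda G A B -> A * fst u + B * snd u = c ->
  exists k a b a' b', path_coords (legendre lambda) (line G u) t k a b a' b' /\
    form_value (legendre lambda) [- RtoC 1] k (a t) (b t) (a' t) (b' t) c.
Proof.
  intros HG Hc. destruct (line G u t) as [x y|] eqn:E.
  - assert (Ht : line G u t <> Inf) by now rewrite E.
    destruct (hom_line_affine lambda A B c G u t HG Hc Ht) as (DX & DY & Hl).
    exists Finite_chart, (fun s => affine_x (line G u s)),
      (fun s => affine_y (line G u s)),
      (fun s => - 2 * affine_y (line G u s) * c),
      (fun s => - (3 * affine_x (line G u s) * affine_x (line G u s)
          - 2 * (1 + lambda) * affine_x (line G u s) + lambda) * c).
    split; [split; [|split]|].
    + revert Hl. apply filter_imp. intros s Hs.
      assert (Hon : on_curve (legendre lambda) (line G u s))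
        by apply (hom_on_curve _ _ _ _ HG).
      destruct (line G u s) as [x' y'|]; [|easy]. split; [exact Hon|reflexivity].
    + unfold C1_near. revert Hl. apply filter_imp. intros s Hs.
      destruct (hom_line_affine lambda A B c G u s HG Hc Hs) as (DXs & DYs & _).
      split; [exact DXs|].
      eapply is_derive_RC_continuous. derive_RC.
    + unfold C1_near. revert Hl. apply filter_imp. intros s Hs.
      destruct (hom_line_affine lambda A B c G u s HG Hc Hs) as (DXs & DYs & _).
      split; [exact DYs|].
      eapply is_derive_RC_continuous. derive_RC.
    + rewrite E. simpl. split; [simpl; ring|]. intros d Hd. simpl numerator.
      enough (d = 3 * x * x - 2 * (1 + lambda) * x + lambda) as -> by (simpl; ring).
      apply (is_derive_RC_rhs_unique (legendre lambda) Finite_chart x _ _ Hd).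
      unfold rhs; simpl. eapply is_derive_RC_eq; [derive_RC|]. cbv beta. ring.
  - assert (Ht : in_infinity_chart (line G u t)) by now rewrite E.
    destruct (hom_line_infinity lambda A B c G u t HG Hc Ht) as (DS & DW & Hl).
    exists Infinity_chart, (fun s => infinity_s (line G u s)),
      (fun s => infinity_w (line G u s)),
      (fun s => 2 * infinity_w (line G u s) * c),
      (fun s => (1 - 2 * (1 + lambda) * infinity_s (line G u s)
      + 3 * lambda * infinity_s (line G u s) * infinity_s (line G u s)) * c).
    split; [split; [|split]|].
    + revert Hl. apply filter_imp. intros s Hs.
      apply infinity_coordinates; [apply (hom_on_curve _ _ _ _ HG)|exact Hs].
    + unfold C1_near. revert Hl. apply filter_imp. intros s Hs.
      destruct (hom_line_infinity lambda A B c G u s HG Hc Hs) as (DXs & DYs & _).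
      split; [exact DXs|].
      eapply is_derive_RC_continuous. derive_RC.
    + unfold C1_near. revert Hl. apply filter_imp. intros s Hs.
      destruct (hom_line_infinity lambda A B c G u s HG Hc Hs) as (DXs & DYs & _).
      split; [exact DYs|].
      eapply is_derive_RC_continuous. derive_RC.
    + rewrite E. simpl. split; [simpl; ring|]. intros d Hd.
      enough (d = 1) as -> by (simpl; ring).
      apply (is_derive_RC_rhs_unique (legendre lambda) Infinity_chart 0 _ _ Hd).
      unfold rhs; simpl. eapply is_derive_RC_eq; [derive_RC|]. cbv beta. ring.
Qed.

(** The line from 0 to [u] is mapped to an arc from infinity to [G u], along
    which the integrand of [Omega] is constant. *)
Lemma J_map_hom (lambda A B : C) (G : C2 -> point) (u : C2) :
  hom_from_C2 lambda G A B ->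
  J_map lambda (G u) = projE lambda (psi_tilde A B u).
Proof.
  intros HG. set (c := psi_tilde A B u).
  pose proof (fun t => hom_line_coords lambda A B c G u t HG eq_refl) as Hcoords.
  clearbody c.
  assert (E0 : line G u 0 = Inf).
  { rewrite <- (hom_zero _ _ _ _ HG). unfold line. f_equal.
    apply injective_projections; simpl; apply Cmult_0_l. }
  assert (E1 : line G u 1 = G u).
  { unfold line. f_equal.
    apply injective_projections; simpl; apply Cmult_1_l. }
  apply (J_map_eq lambda (G u) [line G u] c).
  - split; [|split; [exact E0|split; [|exact E1]]].
    + intros t _. destruct (Hcoords t) as (k & a & b & a' & b' & H & _).
      now exists k, a, b, a', b'.
    + rewrite E1. apply (hom_on_curve _ _ _ _ HG).
  - exists c, (RtoC 0). split; [|split; [reflexivity|ring]].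
    exists (fun _ => c). split.
    + intros t _. apply Hcoords.
    + assert (Hc : scal (V := C_R_NormedModule) (1 - 0)%R c = c).
      { apply injective_projections; simpl; unfold scal; simpl;
          unfold mult; simpl; ring. }
      exact (eq_ind _ (is_RInt (V := C_R_NormedModule) (fun _ => c) 0 1)
               (is_RInt_const (V := C_R_NormedModule) 0 1 c) _ Hc).
Qed.

(** * An arc on a hyperelliptic curve through an unramified point *)

(** The principal square root, on the half plane of positive real part. *)
Definition Csqrt (z : C) : C :=
  let p := sqrt ((Cmod z + fst z) / 2) in (p, snd z / (2 * p))%R.

Lemma Csqrt_sqr (z : C) : (0 < fst z)%R -> Csqrt z * Csqrt z = z.
Proof.
  intros Hz. pose proof (Cmod_ge_0 z) as H0.
  assert (Hm : (Cmod z * Cmod z = fst z * fst z + snd z * snd z)%R).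
  { unfold Cmod. rewrite sqrt_sqrt; nra. }
  set (p := sqrt ((Cmod z + fst z) / 2)).
  assert (Hp : (p * p = (Cmod z + fst z) / 2)%R) by (apply sqrt_sqrt; lra).
  assert (Hp0 : (0 < p)%R) by (apply sqrt_lt_R0; lra).
  unfold Csqrt. fold p. apply injective_projections; simpl.
  - replace (p * p - snd z / (2 * p) * (snd z / (2 * p)))%R
      with (p * p - (snd z * snd z) / (4 * (p * p)))%R by (field; lra).
    rewrite Hp.
    replace (snd z * snd z)%R with
      ((Cmod z - fst z) * (Cmod z + fst z))%R by (ring_simplify; lra).
    field. lra.
  - field. lra.
Qed.

Lemma Csqrt_1 : Csqrt 1 = 1.
Proof.
  unfold Csqrt. rewrite Cmod_1. simpl fst. simpl snd.
  replace ((1 + 1) / 2)%R with 1%R by field. rewrite sqrt_1.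
  apply injective_projections; simpl; field.
Qed.

Lemma Csqrt_neq_0 (z : C) : (0 < fst z)%R -> Csqrt z <> 0.
Proof.
  intros Hz E. apply Csqrt_sqr in Hz as H. rewrite E in H.
  rewrite <- H in Hz. simpl in Hz. lra.
Qed.

Lemma Re_pos_near (z : R -> C) (t : R) (dz : C) :
  is_derive_RC z t dz -> (0 < fst (z t))%R ->
  locally t (fun s => (0 < fst (z s))%R).
Proof.
  intros H%is_derive_RC_continuous Hz.
  assert (L := H _ (locally_ball (z t) (mkposreal _ Hz))).
  unfold filtermap in L. revert L. apply filter_imp. intros s [B1 _].
  change (Rabs (fst (z s) - fst (z t)) < fst (z t))%R in B1.
  apply Rabs_def2 in B1. lra.
Qed.

Lemma is_derive_RC_Csqrt (z : R -> C) (t : R) (dz : C) :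
  is_derive_RC z t dz -> (0 < fst (z t))%R ->
  is_derive_RC (fun s => Csqrt (z s)) t (dz / (2 * Csqrt (z t))).
Proof.
  intros Hd Hz.
  pose proof (proj1 (is_derive_RC_components _ _ _) Hd) as [D1 D2].
  set (u := fun s => fst (z s)) in *. set (v := fun s => snd (z s)) in *.
  assert (Hu : (0 < u t)%R) by exact Hz.
  assert (Hq : (0 < u t * (u t * 1) + v t * (v t * 1))%R) by nra.
  pose proof (sqrt_pos (u t * (u t * 1) + v t * (v t * 1))) as Hs.
  assert (exists l : C, is_derive_RC (fun s => Csqrt (z s)) t l) as [l Hl].
  { pose (p := fun s => sqrt ((sqrt (u s ^ 2 + v s ^ 2) + u s) / 2)).
    assert (ex_derive p t) as [dp Hp].
    { unfold p. auto_derive. repeat split; try (eexists; eassumption); lra. }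
    assert (Hp0 : (0 < p t)%R) by (apply sqrt_lt_R0; simpl; lra).
    assert (ex_derive (fun s => v s / (2 * p s))%R t) as [dq Hq'].
    { auto_derive. repeat split; try (eexists; eassumption). lra. }
    exists (dp, dq). apply is_derive_RC_components. split; assumption. }
  apply (is_derive_RC_eq _ _ _ _ Hl).
  (* The value of the derivative follows from [Csqrt z * Csqrt z = z]. *)
  assert (E : 2 * Csqrt (z t) * l = dz).
  { apply (is_derive_RC_unique z t); [|exact Hd].
    apply (is_derive_RC_ext_loc (fun s => Csqrt (z s) * Csqrt (z s)) z t _ _)
      with (3 := is_derive_RC_mult _ _ t _ _ Hl Hl).
    - generalize (Re_pos_near z t dz Hd Hz). apply filter_imp.
      intros s Hs'. now apply Csqrt_sqr.
    - ring. }
  rewrite <- E. field. now apply Csqrt_neq_0.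
Qed.

(** Two derivatives are needed: the velocity of the arc below involves
    the first one and has to be continuous. *)
Lemma Cprod_path_derive (e : C) (l : list C) :
  exists f' : R -> C, forall t,
    is_derive_RC (fun s => Cprod (map (fun r => e + RtoC s - r) l)) t (f' t) /\
    exists d, is_derive_RC f' t d.
Proof.
  induction l as [|r l [f' IH]].
  - exists (fun _ => RtoC 0). intros t. split.
    + exact (is_derive_RC_const 1 t).
    + exists (RtoC 0). exact (is_derive_RC_const 0 t).
  - set (f := fun s : R => Cprod (map (fun r => e + RtoC s - r) l)) in *.
    exists (fun s : R => (0 + 1 - 0) * f s + (e + RtoC s - r) * f' s).
    intros t. destruct (IH t) as [H1 [d H2]]. split.
    + change (is_derive_RC (fun s : R => (e + RtoC s - r) * f s) t
        ((0 + 1 - 0) * f t + (e + RtoC t - r) * f' t)).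
      derive_RC.
    + eexists. derive_RC.
Qed.

(** Near [e] the function [rhs/y0^2] is close to 1, where the principal
    square root is smooth; [y0] times this root is the ordinate. *)
Lemma curve_arc (X : hcurve) (e y0 : C) :
  on_chart X Finite_chart e y0 -> y0 <> 0 ->
  exists (delta : posreal) (y y' : R -> C),
    y 0%R = y0 /\
    forall t, (Rabs t < delta)%R ->
      y t <> 0 /\ on_chart X Finite_chart (e + RtoC t) (y t) /\
      is_derive_RC y t (y' t) /\ exists d, is_derive_RC y' t d.
Proof.
  intros Hon Hy0. destruct (Cprod_path_derive e (hroots X)) as [f' Hf'].
  set (f := fun s : R => Cprod (map (fun r => e + RtoC s - r) (hroots X))) in *.
  assert (Hyy : y0 * y0 <> 0) by now apply Cmult_neq_0.
  assert (Hf0 : f 0%R = y0 * y0).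
  { unfold f. replace (e + RtoC 0) with e by ring.
    change (rhs X Finite_chart e = y0 * y0). rewrite <- Hon. simpl. ring. }
  set (z := fun s => f s * / (y0 * y0)).
  set (z' := fun s => f' s * / (y0 * y0)).
  assert (Hz' : forall t, is_derive_RC z t (z' t) /\ exists d, is_derive_RC z' t d).
  { intros t. destruct (Hf' t) as [H1 [d H2]]. unfold z, z'. split.
    - eapply is_derive_RC_eq; [derive_RC|]. cbv beta. ring.
    - eexists. derive_RC. }
  assert (Hz0 : z 0%R = 1) by (unfold z; rewrite Hf0; now field).
  assert (Hpos : locally 0%R (fun s => (0 < fst (z s))%R)).
  { apply (Re_pos_near z 0 _ (proj1 (Hz' 0%R))). rewrite Hz0. simpl. lra. }
  destruct Hpos as [delta Hdelta].
  exists delta, (fun s => y0 * Csqrt (z s)),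
    (fun s => y0 * (z' s / (2 * Csqrt (z s)))).
  split; [rewrite Hz0, Csqrt_1; ring|]. intros t Ht.
  assert (Hzt : (0 < fst (z t))%R).
  { apply Hdelta. change (Rabs (t - 0) < delta)%R. now rewrite Rminus_0_r. }
  pose proof (Csqrt_neq_0 _ Hzt) as Hn.
  destruct (Hz' t) as [H1 [d H2]].
  pose proof (is_derive_RC_Csqrt z t _ H1 Hzt) as Hr.
  assert (Hn2 : 2 * Csqrt (z t) <> 0).
  { apply Cmult_neq_0; [|exact Hn]. intros E. injection E. lra. }
  split; [|split; [|split]].
  - now apply Cmult_neq_0.
  - change ((y0 * Csqrt (z t)) ^ 2 = f t).
    transitivity (y0 * y0 * (Csqrt (z t) * Csqrt (z t))); [ring|].
    rewrite (Csqrt_sqr _ Hzt). unfold z. now field.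
  - eapply is_derive_RC_eq; [derive_RC|]. cbv beta. ring.
  - eexists. derive_RC.
Qed.

(** Away from the branch points the two expressions [h da/2b] and [h db/f'(a)]
    of the form agree, because [2 b db = f'(a) da] along the curve. *)
Lemma path_coords_form_value (X : hcurve) (w : hform) (g : R -> point) (t : R)
    (k : chart) (a b a' b' : R -> C) (c : C) :
  path_coords X g t k a b a' b' -> b t <> 0 ->
  2 * b t * c = numerator w k (a t) * a' t ->
  form_value X w k (a t) (b t) (a' t) (b' t) c.
Proof.
  intros [Hl [Ha Hb]] Hbt Hc. split; [exact Hc|]. intros d Hd.
  apply locally_singleton in Ha. apply locally_singleton in Hb.
  pose proof (is_derive_RC_C_comp (rhs X k) a t d _ Hd (proj1 Ha)) as H1.
  pose proof (is_derive_RC_mult b b t _ _ (proj1 Hb) (proj1 Hb)) as H2.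
  assert (E : 2 * b t * b' t = d * a' t).
  { apply (is_derive_RC_unique (fun s => rhs X k (a s)) t _ _) with (2 := H1).
    revert H2. apply is_derive_RC_ext_loc; [|ring].
    revert Hl. apply filter_imp. intros s [E _]. rewrite <- E. simpl. ring. }
  assert (N : 2 * b t <> 0).
  { apply Cmult_neq_0; [|exact Hbt]. intros H. injection H. lra. }
  transitivity (/ (2 * b t) * (d * (2 * b t * c))); [field; exact Hbt|].
  rewrite Hc.
  transitivity (/ (2 * b t) * (numerator w k (a t) * (d * a' t))); [ring|].
  rewrite <- E. field; exact Hbt.
Qed.

Lemma Ceval_path_derive (w : hform) (e : C) (t : R) :
  exists d, is_derive_RC (fun s => Ceval w (e + RtoC s)) t d.
Proof.
  induction w as [|c w [d IH]].
  - exists (RtoC 0). exact (is_derive_RC_const 0 t).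
  - exists (0 + ((0 + 1) * Ceval w (e + RtoC t) + (e + RtoC t) * d)).
    set (p := fun s : R => Ceval w (e + RtoC s)) in *.
    change (is_derive_RC (fun s : R => c + (e + RtoC s) * p s) t
      (0 + ((0 + 1) * p t + (e + RtoC t) * d))).
    derive_RC.
Qed.

(** The initial segment of the arc up to the parameter [t] is an arc on
    [0, 1] after scaling by [t], so the integral of a form along it is an
    integral from 0 to [t], with a known derivative in [t]. *)
Lemma curve_arc_integral (X : hcurve) (e y0 : C) :
  on_chart X Finite_chart e y0 -> y0 <> 0 ->
  exists (delta : posreal) (y : R -> C),
    (forall t, (Rabs t < delta)%R ->
       y t <> 0 /\ on_chart X Finite_chart (e + RtoC t) (y t)) /\
    (forall t, (Rabs t < delta)%R ->
       exists l, is_path X (Aff e y0) l (Aff (e + RtoC t) (y t)) /\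
       forall (w : hform),
         is_path_integral X w l
           (RInt (V := C_R_CompleteNormedModule)
              (fun s => Ceval w (e + RtoC s) / (2 * y s)) 0 t)) /\
    forall (w : hform) t, (Rabs t < delta)%R ->
      is_derive_RC (fun t => RInt (V := C_R_CompleteNormedModule)
              (fun s => Ceval w (e + RtoC s) / (2 * y s)) 0 t) t
         (Ceval w (e + RtoC t) / (2 * y t)).
Proof.
  intros Hon Hy0.
  destruct (curve_arc X e y0 Hon Hy0) as (delta & y & y' & Hy00 & Hy).
  exists delta, y.
  assert (Hnear : forall t, (Rabs t < delta)%R ->
            locally t (fun s => (Rabs s < delta)%R)).
  { intros t Ht. assert (Hp : (0 < delta - Rabs t)%R) by lra.
    exists (mkposreal _ Hp). intros s Hs.
    change (Rabs (s - t) < delta - Rabs t)%R in Hs.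
    pose proof (Rabs_triang_inv s t). lra. }
  pose (h := fun (w : hform) s => Ceval w (e + RtoC s) / (2 * y s)).
  assert (Hh : forall w t, (Rabs t < delta)%R ->
     continuous (T := R_UniformSpace) (U := C_UniformSpace) (h w) t).
  { intros w t Ht. destruct (Hy t Ht) as (Hn & _ & D1 & _).
    destruct (Ceval_path_derive w e t) as [d Hd].
    assert (N : 2 * y t <> 0).
    { apply Cmult_neq_0; [|exact Hn]. intros E. injection E. lra. }
    exact (is_derive_RC_continuous _ t _
      (is_derive_RC_div (fun s : R => Ceval w (e + RtoC s)) (fun s => 2 * y s)
         t d _ N Hd
         (is_derive_RC_mult (fun _ => RtoC 2) y t _ _
            (is_derive_RC_const _ t) D1))). }
  assert (HI : forall w t, (Rabs t < delta)%R ->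
    is_RInt (V := C_R_NormedModule) (h w) 0 t
      (RInt (V := C_R_CompleteNormedModule) (h w) 0 t)).
  { intros w t Ht. apply (RInt_correct (V := C_R_CompleteNormedModule)).
    apply (ex_RInt_continuous (V := C_R_CompleteNormedModule)).
    intros z Hz. apply Hh. unfold Rabs in *.
    revert Hz. unfold Rmin, Rmax.
    repeat destruct Rle_dec; repeat destruct Rcase_abs; lra. }
  split; [|split].
  - intros t Ht. destruct (Hy t Ht) as (H1 & H2 & _). now split.
  - intros t Ht.
    set (g := fun s : R => Aff (e + RtoC s) (y s)).
    assert (Hc : forall s, (Rabs s < delta)%R ->
      path_coords X g s Finite_chart (fun s => e + RtoC s) y (fun _ => RtoC 1) y').
    { intros s Hs. split; [|split].
      - generalize (Hnear s Hs). apply filter_imp. intros r Hr.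
        split; [apply (Hy r Hr)|reflexivity].
      - unfold C1_near. apply filter_forall. intros r. split.
        + apply (is_derive_RC_eq _ _ (0 + 1)); [derive_RC|ring].
        + apply continuous_const.
      - unfold C1_near. generalize (Hnear s Hs). apply filter_imp. intros r Hr.
        destruct (Hy r Hr) as (_ & _ & D1 & d & D2).
        split; [exact D1|]. exact (is_derive_RC_continuous _ _ _ D2). }
    assert (Hin : forall s, (0 <= s <= 1)%R -> (Rabs (t * s + 0) < delta)%R).
    { intros s Hs. rewrite Rplus_0_r, Rabs_mult, (Rabs_pos_eq s) by lra.
      pose proof (Rabs_pos t). nra. }
    exists [fun s => g (t * s + 0)%R]. split.
    + split; [|split; [|split]].
      * intros s Hs. do 5 eexists.
        exact (path_coords_affine X g t 0 s _ _ _ _ _ (Hc _ (Hin s Hs))).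
      * unfold g. rewrite Rmult_0_r, Rplus_0_r, Hy00. f_equal. ring.
      * rewrite Rmult_1_r, Rplus_0_r. apply (Hy t Ht).
      * now rewrite Rmult_1_r, Rplus_0_r.
    + intros w. exists (RInt (V := C_R_CompleteNormedModule) (h w) 0 t), (RtoC 0).
      split; [|split; [reflexivity|symmetry; apply Cplus_0_r]].
      exists (fun s => RtoC t * h w (t * s + 0)%R). split.
      * intros s Hs. do 5 eexists. split.
        -- exact (path_coords_affine X g t 0 s _ _ _ _ _ (Hc _ (Hin s Hs))).
        -- cbv beta. apply form_value_scal.
           apply (path_coords_form_value X w g (t * s + 0)%R Finite_chart
                    (fun s => e + RtoC s) y (fun _ => RtoC 1) y').
           ++ apply Hc. now apply Hin.
           ++ apply (Hy _ (Hin s Hs)).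
           ++ unfold h. simpl numerator. field.
              apply (Hy _ (Hin s Hs)).
      * apply (is_RInt_ext (V := C_R_NormedModule)
             (fun s => scal t (h w (t * s + 0)%R))).
        { intros s _. apply injective_projections; simpl; unfold scal; simpl;
            unfold mult; simpl; ring. }
        apply (is_RInt_comp_lin (V := C_R_NormedModule)).
        replace (t * 0 + 0)%R with 0%R by ring.
        replace (t * 1 + 0)%R with t by ring. now apply HI.
  - intros w t Ht.
    apply (is_derive_RInt (V := C_R_NormedModule) (h w) _ 0 t).
    + generalize (Hnear t Ht). apply filter_imp. intros s Hs. now apply HI.
    + now apply Hh.
Qed.

(** * The differential of the pushforward *)

(** Along the arc, [x = e + t] and [X = K x/t^2], hence
    [X' = - K (t + 2 e)/t^3]; on the other hand [Y = M y/t^3] and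
    [X' = -2 Y (A x + B) (-1/2y) = M (A x + B)/t^3].  So
    [M (A (e + t) + B) = - K (t + 2 e)], and two values of [t] determine [A]
    and [B]. *)
Lemma pushforward_differential (alpha beta lambda e y0 K M A B : C)
    (phi : point -> point) (F : JacV alpha beta -> point) :
  on_chart (curveV alpha beta) Finite_chart e y0 -> y0 <> 0 ->
  (forall P, on_curve (curveV alpha beta) P ->
     phi P = F (I_map alpha beta (Aff e y0) P)) ->
  hom_from_C2 lambda (fun u => F (projV alpha beta u)) A B ->
  (forall x y, x <> e ->
     phi (Aff x y) = Aff (K * x / (x - e) ^ 2) (M * y / (x - e) ^ 3)) ->
  M * A = - K /\ M * B = - (K * e).
Proof.
  intros Hon Hy0 Hphi HG Hform.
  destruct (curve_arc_integral _ e y0 Hon Hy0)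
    as (delta & y & Hy & Hpath & Hder).
  set (I := fun (w : hform) (t : R) => RInt (V := C_R_CompleteNormedModule)
              (fun s => Ceval w (e + RtoC s) / (2 * y s)) 0 t) in *.
  pose (U := fun t => (I [RtoC 0; - RtoC 1] t, I [- RtoC 1; RtoC 0] t) : C2).
  assert (HU : forall t, (Rabs t < delta)%R ->
            F (projV alpha beta (U t)) = phi (Aff (e + RtoC t) (y t))).
  { intros t Ht. destruct (Hpath t Ht) as (l & Hl & Hint).
    rewrite Hphi by apply (Hy t Ht).
    rewrite (I_map_eq alpha beta _ _ l (U t) Hl); [reflexivity|].
    split; apply Hint. }
  assert (Hlin : forall t, (0 < t < delta)%R ->
            M * (A * (e + RtoC t) + B) = - K * (RtoC t + 2 * e)).
  { intros t [Ht0 Ht].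
    assert (Hta : (Rabs t < delta)%R) by (rewrite Rabs_pos_eq; lra).
    assert (Hne : forall s : R, (0 < s)%R -> RtoC s <> 0).
    { intros s Hs E. injection E. lra. }
    assert (Hxe : forall s : R, (0 < s)%R -> e + RtoC s <> e).
    { intros s Hs E. apply (Hne s Hs).
      transitivity (e + RtoC s - e); [ring|]. rewrite E. ring. }
    destruct (Hy t Hta) as (Hyt & _).
    assert (HGt := HU t Hta).
    rewrite (Hform _ _ (Hxe t Ht0)) in HGt.
    destruct (hom_near_affine lambda _ A B U t _ _ _ _ _ HG eq_refl
               (Hder _ t Hta) (Hder _ t Hta) HGt) as (X & Y & DX & _ & Hl).
    assert (DX' : is_derive_RC (fun s : R => K * (e + RtoC s) / (RtoC s * RtoC s)) t
       (((0 * (e + RtoC t) + K * (0 + 1)) * (RtoC t * RtoC t)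
          - K * (e + RtoC t) * (1 * RtoC t + RtoC t * 1))
        / (RtoC t * RtoC t * (RtoC t * RtoC t)))).
    { assert (RtoC t * RtoC t <> 0) by (apply Cmult_neq_0; now apply Hne).
      derive_RC. }
    assert (Hpos : locally t (fun s : R => (0 < s < delta)%R)).
    { apply (open_and (fun s => 0 < s)%R (fun s => s < delta)%R);
        [apply open_gt|apply open_lt|lra]. }
    assert (HX : locally t (fun s => X s = K * (e + RtoC s) / (RtoC s * RtoC s))).
    { generalize (filter_and _ _ Hl Hpos). apply filter_imp.
      intros s [Es Hs]. assert (Hsa : (Rabs s < delta)%R) by (rewrite Rabs_pos_eq; lra).
      rewrite (HU s Hsa), (Hform _ _ (Hxe s (proj1 Hs))) in Es.
      injection Es as <- _.
      replace (e + RtoC s - e) with (RtoC s) by ring. field. now apply Hne. }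
    pose proof (is_derive_RC_unique _ t _ _
                  (is_derive_RC_ext_loc _ _ t _ _ HX eq_refl DX) DX') as E.
    pose proof (Hne t Ht0) as Nt. clear - E Nt Hyt.
    simpl Ceval in E. generalize dependent (RtoC t). intros T E NT.
    generalize dependent (y t). intros z Nz E.
    replace (e + T - e) with T in E by ring.
    transitivity (T ^ 3 * (- 2 * (M * z / T ^ 3) *
      (A * ((0 + (e + T) * (- (1) + (e + T) * 0)) / (2 * z)) +
       B * ((- (1) + (e + T) * (0 + (e + T) * 0)) / (2 * z))))).
    { field. now split. }
    rewrite E. field. exact NT. }
  pose proof (cond_pos delta) as Hd.
  pose proof (Hlin (delta / 2)%R ltac:(lra)) as L1.
  pose proof (Hlin (delta / 3)%R ltac:(lra)) as L2.
  assert (N : RtoC (delta / 2) - RtoC (delta / 3) <> 0).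
  { intros E. injection E. lra. }
  generalize dependent (RtoC (delta / 2)). intros p L1.
  generalize dependent (RtoC (delta / 3)). intros q L2 N.
  assert (HA : M * A = - K).
  { transitivity ((M * (A * (e + p) + B) - M * (A * (e + q) + B)) / (p - q)).
    - field. exact N.
    - rewrite L1, L2. field. exact N. }
  split; [exact HA|].
  transitivity (M * (A * (e + p) + B) - M * A * (e + p)); [ring|].
  rewrite L1, HA. ring.
Qed.

Lemma psi_star_lift (alpha beta lambda e y0 K M : C)
    (phi : point -> point) (F : JacV alpha beta -> point) :
  on_chart (curveV alpha beta) Finite_chart e y0 -> y0 <> 0 ->
  is_pushforward alpha beta lambda phi (Aff e y0) F ->
  (forall x y, x <> e ->
     phi (Aff x y) = Aff (K * x / (x - e) ^ 2) (M * y / (x - e) ^ 3)) ->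
  M <> 0 ->
  forall u : C2,
    psi_star alpha beta lambda F (projV alpha beta u) =
    projE lambda (psi_tilde (- (K / M)) (- (K / M) * e) u).
Proof.
  intros Hon Hy0 [Hhol Hphi] Hform HM u.
  destruct (holomorphic_hom_lift alpha beta lambda F Hhol) as (A & B & HG).
  destruct (pushforward_differential alpha beta lambda e y0 K M A B phi F
              Hon Hy0 Hphi HG Hform) as [HA HB].
  replace (- (K / M)) with A.
  2:{ transitivity (M * A / M); [now field|]. rewrite HA. now field. }
  replace (A * e) with B.
  2:{ transitivity (M * B / M); [now field|]. rewrite HB.
      transitivity (- K * e / M); [now field|]. rewrite <- HA. now field. }
  exact (J_map_hom lambda A B _ u HG).
Qed.

Theorem proposition4p1 (alpha beta r1 r2 : C)
  (ha0 : alpha ^ 2 <> 0) (ha1 : alpha ^ 2 <> 1)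
  (hb0 : beta ^ 2 <> 0) (hb1 : beta ^ 2 <> 1)
  (hab : alpha ^ 2 <> beta ^ 2) (hab1 : alpha ^ 2 * beta ^ 2 <> 1)
  (hr1 : r1 ^ 2 = alpha * beta) (hr2 : r2 ^ 2 = - (alpha * beta))
  (phi1_star phi2_star : JacV alpha beta -> point)
  (hphi1 : is_pushforward alpha beta (lambda1 alpha beta)
             (phi1 alpha beta) (O1 alpha beta r1) phi1_star)
  (hphi2 : is_pushforward alpha beta (lambda2 alpha beta)
             (phi2 alpha beta) (O2 alpha beta r2) phi2_star) :
  (forall u : C2,
     psi_star alpha beta (lambda1 alpha beta) phi1_star (projV alpha beta u) =
     projE (lambda1 alpha beta)
       (psi_tilde (1 - alpha * beta) (alpha * beta * (1 - alpha * beta)) u)) /\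
  (forall u : C2,
     psi_star alpha beta (lambda2 alpha beta) phi2_star (projV alpha beta u) =
     projE (lambda2 alpha beta)
       (psi_tilde (alpha * beta + 1) (- (alpha * beta) * (alpha * beta + 1)) u)).
Proof.
  assert (Na : alpha <> 0) by (intros ->; apply ha0; ring).
  assert (Nb : beta <> 0) by (intros ->; apply hb0; ring).
  assert (Nm : alpha - beta <> 0).
  { intros E. apply hab. transitivity ((alpha - beta) * (alpha + beta) + beta ^ 2);
      [ring|]. rewrite E. ring. }
  assert (Np : alpha + beta <> 0).
  { intros E. apply hab. transitivity ((alpha - beta) * (alpha + beta) + beta ^ 2);
      [ring|]. rewrite E. ring. }
  assert (Nabm : alpha * beta - 1 <> 0).
  { intros E. apply hab1.
    transitivity ((alpha * beta - 1) * (alpha * beta + 1) + 1); [ring|].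
    rewrite E. ring. }
  assert (Nabp : alpha * beta + 1 <> 0).
  { intros E. apply hab1.
    transitivity ((alpha * beta - 1) * (alpha * beta + 1) + 1); [ring|].
    rewrite E. ring. }
  assert (Nab : alpha * beta <> 0) by now apply Cmult_neq_0.
  assert (Nr1 : r1 <> 0).
  { intros ->. apply Nab. rewrite <- hr1. ring. }
  assert (Nr2 : r2 <> 0).
  { intros ->. apply Nab. transitivity (- - (alpha * beta)); [ring|].
    rewrite <- hr2. ring. }
  split; intros u.
  (* [K = (alpha - beta)^2] and [M = K / (alpha beta - 1)]. *)
  - replace (1 - alpha * beta) with
      (- ((alpha - beta) ^ 2 / ((alpha - beta) ^ 2 / (alpha * beta - 1))))
      by (field; now split).
    rewrite (Cmult_comm (alpha * beta)).
    apply (psi_star_lift alpha beta _ (alpha * beta)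
      (alpha * beta * r1 * (alpha * beta - 1) * (alpha - beta))
      _ _ (phi1 alpha beta)).
    + unfold on_chart. simpl rhs.
      transitivity
        (r1 ^ 2 * ((alpha * beta) ^ 2 * (alpha * beta - 1) ^ 2
           * (alpha - beta) ^ 2)); [ring|].
      rewrite hr1. unfold Cprod. simpl. ring.
    + repeat apply Cmult_neq_0; assumption.
    + exact hphi1.
    + intros x y Hx. simpl. destruct (Ceq_dec x (alpha * beta)) as [E|_]; [easy|].
      assert (Nx : x - alpha * beta <> 0).
      { intros E. apply Hx.
        transitivity (x - alpha * beta + alpha * beta); [ring|]. rewrite E. ring. }
      f_equal. field. now split.
    + intros E. apply Nm.
      destruct (Ceq_dec (alpha - beta) 0) as [E'|N]; [exact E'|exfalso].
      apply (Cmult_neq_0 _ _ N N).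
      transitivity ((alpha - beta) ^ 2 / (alpha * beta - 1) * (alpha * beta - 1));
        [now field|]. rewrite E. ring.
  (* [K = (alpha + beta)^2] and [M = - K / (alpha beta + 1)]. *)
  - replace (alpha * beta + 1) with
      (- ((alpha + beta) ^ 2 / (- (alpha + beta) ^ 2 / (alpha * beta + 1))))
      by (field; now split).
    rewrite (Cmult_comm (- (alpha * beta))).
    apply (psi_star_lift alpha beta _ (- (alpha * beta))
      (alpha * beta * r2 * (alpha * beta + 1) * (alpha + beta))
      _ _ (phi2 alpha beta)).
    + unfold on_chart. simpl rhs.
      transitivity
        (r2 ^ 2 * ((alpha * beta) ^ 2 * (alpha * beta + 1) ^ 2
           * (alpha + beta) ^ 2)); [ring|].
      rewrite hr2. unfold Cprod. simpl. ring.
    + repeat apply Cmult_neq_0; assumption.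
    + exact hphi2.
    + intros x y Hx. simpl. destruct (Ceq_dec x (- (alpha * beta))) as [E|_]; [easy|].
      assert (Nx : x + alpha * beta <> 0).
      { intros E. apply Hx.
        transitivity (x + alpha * beta - alpha * beta); [ring|]. rewrite E. ring. }
      replace (x - - (alpha * beta)) with (x + alpha * beta) by ring.
      f_equal. field. now split.
    + intros E. apply Np.
      destruct (Ceq_dec (alpha + beta) 0) as [E'|N]; [exact E'|exfalso].
      apply (Cmult_neq_0 _ _ N N).
      transitivity (- (- (alpha + beta) ^ 2 / (alpha * beta + 1) * (alpha * beta + 1)));
        [now field|]. rewrite E. ring.
Qed.
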